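(* ($\mathsf{WKL}_0$) Every partial order with countably many initial intervals has no infinite antichains.
   Context: Provability in $\mathsf{WKL}_0$. A partial order $(P,\preceq)$ has $P\subseteq\mathbb{N}$. An antichain is a set of pairwise incomparable elements. An initial interval of $P$ is $I\subseteq P$ with $x\preceq y\in I\Rightarrow x\in I$. $P$ has countably many initial intervals if there is a sequence $\{I_n:n\in\mathbb{N}\}$ (coded by one set) such that every initial interval of $P$ equals some $I_n$. *)

(* Defs.v *)
(* Second-order arithmetic as a two-sorted first-order theory: its syntax, a
   classical natural deduction calculus, and the systems RCA_0 and WKL_0. *)
From Stdlib Require Import List.
Import ListNotations.

(* De Bruijn indices, with separate counters for number and set variables:
   [AllN] binds number variable 0 only, [AllS] binds set variable 0 only. *)
Inductive term : Type :=
| Var (n : nat)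
| Zero
| One
| Add (s t : term)
| Mul (s t : term).

Inductive form : Type :=
| Eq (s t : term)
| Lt (s t : term)
| Mem (t : term) (X : nat)
| Bot
| Imp (p q : form)
| AllN (p : form)
| AllS (p : form).

Definition Neg p := Imp p Bot.
Definition And p q := Neg (Imp p (Neg q)).
Definition Or p q := Imp (Neg p) q.
Definition Iff p q := And (Imp p q) (Imp q p).
Definition ExN p := Neg (AllN (Neg p)).
Definition ExS p := Neg (AllS (Neg p)).

Declare Scope L2t_scope.
Delimit Scope L2t_scope with L2t.
Bind Scope L2t_scope with term.
Declare Scope L2_scope.
Delimit Scope L2_scope with L2.
Bind Scope L2_scope with form.

Notation "# n" := (Var n) (at level 1, n at level 0, format "# n") : L2t_scope.
Notation "s + t" := (Add s t) : L2t_scope.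
Notation "s * t" := (Mul s t) : L2t_scope.
Notation "s == t" := (Eq s t) (at level 70, no associativity) : L2_scope.
Notation "s << t" := (Lt s t) (at level 70, no associativity) : L2_scope.
Notation "t \in X" := (Mem t X) (at level 70, no associativity) : L2_scope.
Notation "~ p" := (Neg p) : L2_scope.
Notation "p /\ q" := (And p q) : L2_scope.
Notation "p \/ q" := (Or p q) : L2_scope.
Notation "p <-> q" := (Iff p q) : L2_scope.
Notation "p ⟶ q" := (Imp p q) (at level 99, right associativity) : L2_scope.

(* Simultaneous substitution of terms for number variables and of set variables
   for set variables.  Terms contain no binder, so shifting a term is a special
   case. *)
Fixpoint tsubst (f : nat -> term) (t : term) : term :=
  match t with
  | Var n => f n
  | Zero => Zero
  | One => One
  | Add s t => Add (tsubst f s) (tsubst f t)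
  | Mul s t => Mul (tsubst f s) (tsubst f t)
  end.

Definition lift (k : nat) : term -> term := tsubst (fun n => Var (k + n)).

Definition scons {A : Type} (a : A) (f : nat -> A) (n : nat) : A :=
  match n with 0 => a | S n => f n end.

Fixpoint subst (f : nat -> term) (g : nat -> nat) (p : form) : form :=
  match p with
  | Eq s t => Eq (tsubst f s) (tsubst f t)
  | Lt s t => Lt (tsubst f s) (tsubst f t)
  | Mem t X => Mem (tsubst f t) (g X)
  | Bot => Bot
  | Imp p q => Imp (subst f g p) (subst f g q)
  | AllN p => AllN (subst (scons (Var 0) (fun n => lift 1 (f n))) g p)
  | AllS p => AllS (subst f (scons 0 (fun n => S (g n))) p)
  end.

Definition shiftN : form -> form := subst (fun n => Var (S n)) (fun X => X).
Definition shiftS : form -> form := subst Var S.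
Definition instN (t : term) : form -> form := subst (scons t Var) (fun X => X).
Definition instS (X : nat) : form -> form := subst Var (scons X (fun Y => Y)).

(* [prv T G p]: p is derivable from the axioms T and the open assumptions G.
   The generalization rules shift G but not T, so an axiom with free variables
   has the force of its universal closure. *)
Inductive prv (T : form -> Prop) : list form -> form -> Prop :=
| prv_ax G p : T p -> prv T G p
| prv_hyp G p : In p G -> prv T G p
| prv_impI G p q : prv T (p :: G) q -> prv T G (Imp p q)
| prv_impE G p q : prv T G (Imp p q) -> prv T G p -> prv T G q
| prv_raa G p : prv T (Neg p :: G) Bot -> prv T G p
| prv_allNI G p : prv T (map shiftN G) p -> prv T G (AllN p)
| prv_allNE G p t : prv T G (AllN p) -> prv T G (instN t p)
| prv_allSI G p : prv T (map shiftS G) p -> prv T G (AllS p)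
| prv_allSE G p X : prv T G (AllS p) -> prv T G (instS X p)
| prv_eqI G t : prv T G (Eq t t)
| prv_eqE G s t p : prv T G (Eq s t) -> prv T G (instN s p) -> prv T G (instN t p).

Notation "T |-- p" := (prv T [] p%L2) (at level 90, no associativity).

(** * RCA_0 *)

Local Open Scope L2t_scope.
Local Open Scope L2_scope.

Inductive basic_axiom : form -> Prop :=
| ax_succ_neq0 : basic_axiom (~ (#0 + One == Zero))
| ax_succ_inj : basic_axiom ((#0 + One == #1 + One) ⟶ (#0 == #1))
| ax_add0 : basic_axiom (#0 + Zero == #0)
| ax_addS : basic_axiom (#0 + (#1 + One) == (#0 + #1) + One)
| ax_mul0 : basic_axiom (#0 * Zero == Zero)
| ax_mulS : basic_axiom (#0 * (#1 + One) == #0 * #1 + #0)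
| ax_lt0 : basic_axiom (~ (#0 << Zero))
| ax_ltS : basic_axiom ((#0 << #1 + One) <-> ((#0 << #1) \/ (#0 == #1))).

(* The class Sigma^0_0; set parameters are allowed.  Bounded existential
   quantifiers are obtained as negated bounded universal ones. *)
Inductive bounded : form -> Prop :=
| bd_eq s t : bounded (s == t)
| bd_lt s t : bounded (s << t)
| bd_mem t X : bounded (t \in X)
| bd_bot : bounded Bot
| bd_imp p q : bounded p -> bounded q -> bounded (p ⟶ q)
| bd_all t p : bounded p -> bounded (AllN ((#0 << lift 1 t) ⟶ p)).

Inductive Sigma1 : form -> Prop :=
| Sigma1_intro p : bounded p -> Sigma1 (ExN p).

Inductive Pi1 : form -> Prop :=
| Pi1_intro p : bounded p -> Pi1 (AllN p).

(* In both schemes the distinguished number variable of p and q is #0; the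
   other free variables are parameters. *)
Definition induction_for (p : form) : form :=
  (instN Zero p
   /\ AllN (p ⟶ subst (scons (#0 + One) (fun n => #(S n))) (fun X => X) p))
  ⟶ AllN p.

Definition comprehension_for (p q : form) : form :=
  AllN (p <-> q) ⟶ ExS (AllN ((#0 \in 0) <-> shiftS p)).

Inductive RCA0 : form -> Prop :=
| RCA0_basic p : basic_axiom p -> RCA0 p
| RCA0_Sigma1_ind p : Sigma1 p -> RCA0 (induction_for p)
| RCA0_Delta1_comp p q : Sigma1 p -> Pi1 q -> RCA0 (comprehension_for p q).

(** * Coding of finite sequences, and WKL_0 *)

Definition tpair (s t : term) : term := (s + t) * (s + t) + s.

Definition divides (s t : term) : form := ExN (lift 1 s * #0 == lift 1 t).

(* A triple c = (k,(m,n)) codes the finite set of all x < k such that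
   m(x+1)+1 divides n (Simpson's coding). *)
Definition is_triple (c : term) : form :=
  ExN (ExN (ExN (lift 3 c == tpair #2 (tpair #1 #0)))).

Definition elt (x c : term) : form :=
  ExN (ExN (ExN ((lift 3 c == tpair #2 (tpair #1 #0))
                 /\ ((lift 3 x << #2)
                     /\ divides (#1 * (lift 3 x + One) + One) #0)))).

(* s codes a sequence of length l, that is, its domain is {i : i < l}. *)
Definition has_length (s l : term) : form :=
  AllN ((#0 << lift 1 l) <-> ExN (elt (tpair #1 #0) (lift 2 s))).

(* A finite sequence is a finite set of pairs which is a function with domain
   {i : i < l} for some l; its code is the least triple coding that set. *)
Definition Seq (s : term) : form :=
  is_triple s
  /\ AllN (elt #0 (lift 1 s) ⟶ ExN (ExN (#2 == tpair #1 #0)))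
  /\ AllN (AllN (AllN ((elt (tpair #2 #1) (lift 3 s) /\ elt (tpair #2 #0) (lift 3 s))
                       ⟶ (#1 == #0))))
  /\ ExN (has_length (lift 1 s) #0)
  /\ AllN (((#0 << lift 1 s) /\ is_triple #0)
           ⟶ ~ AllN (elt #0 #1 <-> elt #0 (lift 2 s))).

Definition binary (s : term) : form :=
  AllN (AllN (elt (tpair #1 #0) (lift 2 s) ⟶ (#0 << One + One))).

(* As sequences are sets of pairs, t is an initial segment of s iff t is
   included in s. *)
Definition initial_segment (t s : term) : form :=
  AllN (elt #0 (lift 1 t) ⟶ elt #0 (lift 1 s)).

Definition binary_tree (T : nat) : form :=
  AllN ((#0 \in T) ⟶ (Seq #0 /\ binary #0))
  /\ AllN (AllN (((#1 \in T) /\ Seq #0 /\ initial_segment #0 #1)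
                 ⟶ (#0 \in T))).

Definition infinite (X : nat) : form :=
  AllN (ExN ((#1 << #0) /\ (#0 \in X))).

Definition total_function (F : nat) : form :=
  AllN ((#0 \in F) ⟶ ExN (ExN (#2 == tpair #1 #0)))
  /\ AllN (ExN (tpair #1 #0 \in F))
  /\ AllN (AllN (AllN (((tpair #2 #1 \in F) /\ (tpair #2 #0 \in F))
                       ⟶ (#1 == #0)))).

(* For every n, the code of the sequence F(0), ..., F(n-1) belongs to T. *)
Definition path (F T : nat) : form :=
  total_function F
  /\ AllN (ExN ((#0 \in T) /\ has_length #0 #1
                /\ AllN (elt #0 #1 ⟶ (#0 \in F)))).

Definition weak_Koenig : form :=
  AllS ((binary_tree 0 /\ infinite 0) ⟶ ExS (path 0 1)).

Inductive WKL0 : form -> Prop :=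
| WKL0_RCA0 p : RCA0 p -> WKL0 p
| WKL0_WKL : WKL0 weak_Koenig.

(** * Partial orders and initial intervals *)

(* A partial order is a set P with a set R of pairs, (x,y) in R meaning that
   x is below y. *)
Definition partial_order (P R : nat) : form :=
  AllN ((#0 \in R)
        ⟶ ExN (ExN ((#2 == tpair #1 #0) /\ (#1 \in P) /\ (#0 \in P))))
  /\ AllN ((#0 \in P) ⟶ (tpair #0 #0 \in R))
  /\ AllN (AllN (((tpair #1 #0 \in R) /\ (tpair #0 #1 \in R)) ⟶ (#1 == #0)))
  /\ AllN (AllN (AllN (((tpair #2 #1 \in R) /\ (tpair #1 #0 \in R))
                       ⟶ (tpair #2 #0 \in R)))).

Definition initial_interval (P R I : nat) : form :=
  AllN ((#0 \in I) ⟶ (#0 \in P))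
  /\ AllN (AllN (((tpair #1 #0 \in R) /\ (#0 \in I)) ⟶ (#1 \in I))).

Definition antichain (P R D : nat) : form :=
  AllN ((#0 \in D) ⟶ (#0 \in P))
  /\ AllN (AllN (((#1 \in D) /\ (#0 \in D) /\ ~ (#1 == #0))
                 ⟶ (~ (tpair #1 #0 \in R) /\ ~ (tpair #0 #1 \in R)))).

(* The sequence of sets coded by Z is I_n = {x : (n,x) in Z}.  The set variables
   P and R are shifted past the two set quantifiers: 1 is Z and 0 is I. *)
Definition countably_many_initial_intervals (P R : nat) : form :=
  ExS (AllS (initial_interval (S (S P)) (S (S R)) 0
             ⟶ ExN (AllN ((#0 \in 0) <-> (tpair #1 #0 \in 1))))).

Definition has_infinite_antichain (P R : nat) : form :=
  ExS (antichain (S P) (S R) 0 /\ infinite 0).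

(* Main.v *)
(* By completeness of the calculus (a Henkin construction), it suffices to argue
   inside an arbitrary, possibly nonstandard, model of WKL_0.  There, let D be an
   infinite antichain and let Z list the initial intervals I_n.  Sigma_1 induction
   yields an increasing enumeration d_0 < d_1 < ... in D, and Delta_1 comprehension
   the diagonal set X of all d_n outside I_n.  As D is an antichain, every finite
   part of the order carries an initial interval that contains X and avoids D \ X,
   so a path through the tree of these approximations is an initial interval I
   with d_n in I iff d_n is not in I_n, for all n: I is not listed. *)
From Stdlib Require Import List Arith Lia Cantor Classical ClassicalEpsilon
  FunctionalExtensionality PropExtensionality ProofIrrelevance.
Require Import Defs.
Import ListNotations.

(** * Substitution *)

(** The obvious initial interval around [X], its downward closure, is only Sigma_1 and need not
    exist as a set in RCA_0. The upward closure of [D \ X] is Sigma_1 as well, and since [D] is an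
    antichain the two are disjoint. Weak Koenig's lemma separates two such sets, and the tree also
    forces the separating set to be closed downwards. [X] itself avoids this difficulty: an
    increasing enumeration satisfies i <= d_i, so whether x is some d_i is settled by the
    enumeration up to index x, and every code of that enumeration gives the same answer.

    Passing to a model replaces formal derivations by ordinary mathematics, but each induction and
    each comprehension then owes a proof that its predicate is expressed by a formula of the right
    complexity. Here the Henkin model helps: its assignment names every number by a term and every
    set by a variable, so arbitrary elements may serve as parameters. Since the model may be
    nonstandard, finite sets and sequences have to be internal codes, obtained by Sigma_1
    induction. *)

Lemma tsubst_ext f f' t : (forall n, f n = f' n) -> tsubst f t = tsubst f' t.
Proof. intros H; induction t; simpl; congruence. Qed.

Lemma tsubst_id t : tsubst Var t = t.
Proof. induction t; simpl; congruence. Qed.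

Lemma tsubst_comp f f' t :
  tsubst f' (tsubst f t) = tsubst (fun n => tsubst f' (f n)) t.
Proof. induction t; simpl; congruence. Qed.

Definition upN (f : nat -> term) : nat -> term :=
  scons (Var 0) (fun n => lift 1 (f n)).
Definition upS (g : nat -> nat) : nat -> nat := scons 0 (fun n => S (g n)).

Lemma subst_ext f f' g g' p :
  (forall n, f n = f' n) -> (forall n, g n = g' n) -> subst f g p = subst f' g' p.
Proof.
  intros Hf Hg; apply functional_extensionality in Hf, Hg; now subst.
Qed.

Lemma subst_id p : subst Var (fun X => X) p = p.
Proof.
  induction p; simpl; rewrite ?tsubst_id; try congruence; f_equal.
  - rewrite <- IHp at 2; apply subst_ext; trivial; intros [|n]; reflexivity.
  - rewrite <- IHp at 2; apply subst_ext; trivial; intros [|n]; reflexivity.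
Qed.

Lemma tsubst_upN f t : tsubst (upN f) (lift 1 t) = lift 1 (tsubst f t).
Proof. unfold lift; rewrite !tsubst_comp; now apply tsubst_ext. Qed.

Lemma subst_comp f f' g g' p :
  subst f' g' (subst f g p) =
  subst (fun n => tsubst f' (f n)) (fun X => g' (g X)) p.
Proof.
  revert f f' g g'; induction p; intros; simpl; rewrite ?tsubst_comp; f_equal; auto.
  - rewrite IHp; apply subst_ext; trivial; intros [|n]; trivial.
    apply (tsubst_upN f').
  - rewrite IHp; apply subst_ext; trivial; now intros [|n].
Qed.

Lemma instN_subst f g t p :
  subst f g (instN t p) = instN (tsubst f t) (subst (upN f) g p).
Proof.
  unfold instN; rewrite !subst_comp; apply subst_ext; trivial.
  intros [|n]; simpl; trivial.
  unfold lift; rewrite tsubst_comp; simpl; now rewrite tsubst_id.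
Qed.

Lemma instS_subst f g X p :
  subst f g (instS X p) = instS (g X) (subst f (upS g) p).
Proof.
  unfold instS; rewrite !subst_comp; apply subst_ext.
  - intros n; now rewrite tsubst_id.
  - now intros [|n].
Qed.

Lemma instN_upN f g t p : instN t (subst (upN f) g p) = subst (scons t f) g p.
Proof.
  unfold instN; rewrite subst_comp; apply subst_ext; trivial.
  intros [|n]; simpl; trivial.
  unfold lift; rewrite tsubst_comp; apply tsubst_id.
Qed.

Lemma instS_upS f g X p : instS X (subst f (upS g) p) = subst f (scons X g) p.
Proof.
  unfold instS; rewrite subst_comp; apply subst_ext.
  - intros n; apply tsubst_id.
  - now intros [|n].
Qed.

Lemma shiftN_subst f g p : subst (upN f) g (shiftN p) = shiftN (subst f g p).
Proof. unfold shiftN; rewrite !subst_comp; now apply subst_ext. Qed.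

Lemma shiftS_subst f g p : subst f (upS g) (shiftS p) = shiftS (subst f g p).
Proof.
  unfold shiftS; rewrite !subst_comp; apply subst_ext; trivial.
  intros n; simpl; now rewrite tsubst_id.
Qed.

(* Upper bounds for all indices occurring in an expression, bound ones included. *)
Fixpoint tbound (t : term) : nat :=
  match t with
  | Var n => S n
  | Zero | One => 0
  | Add s t | Mul s t => Nat.max (tbound s) (tbound t)
  end.

Fixpoint nbound (p : form) : nat :=
  match p with
  | Eq s t | Lt s t => Nat.max (tbound s) (tbound t)
  | Mem t _ => tbound t
  | Bot => 0
  | Imp p q => Nat.max (nbound p) (nbound q)
  | AllN p | AllS p => nbound p
  end.

Fixpoint sbound (p : form) : nat :=
  match p with
  | Eq _ _ | Lt _ _ | Bot => 0
  | Mem _ X => S X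
  | Imp p q => Nat.max (sbound p) (sbound q)
  | AllN p | AllS p => sbound p
  end.

Lemma tsubst_bound f f' t :
  (forall n, n < tbound t -> f n = f' n) -> tsubst f t = tsubst f' t.
Proof.
  induction t; simpl; intros H; auto; f_equal;
    (apply IHt1 || apply IHt2); intros; apply H; lia.
Qed.

Lemma subst_bound f f' g g' p :
  (forall n, n < nbound p -> f n = f' n) ->
  (forall X, X < sbound p -> g X = g' X) -> subst f g p = subst f' g' p.
Proof.
  revert f f' g g'; induction p; simpl; intros f f' g g' Hf Hg; f_equal; auto;
    try (apply tsubst_bound; intros; apply Hf; lia);
    try ((apply IHp1 || apply IHp2); intros; (apply Hf || apply Hg); lia).
  - apply IHp; trivial; intros [|n] Hn; simpl; trivial; rewrite Hf; trivial; lia.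
  - apply IHp; trivial; intros [|n] Hn; simpl; trivial; rewrite Hg; trivial; lia.
Qed.

(** * Derivations *)

Lemma prv_weaken T G G' p : prv T G p -> incl G G' -> prv T G' p.
Proof.
  intros H; revert G'; induction H; intros G' HG.
  - now apply prv_ax.
  - apply prv_hyp; auto.
  - apply prv_impI, IHprv; intros x [->|Hx]; simpl; auto.
  - eapply prv_impE; eauto.
  - apply prv_raa, IHprv; intros x [->|Hx]; simpl; auto.
  - apply prv_allNI, IHprv, incl_map, HG.
  - apply prv_allNE; auto.
  - apply prv_allSI, IHprv, incl_map, HG.
  - apply prv_allSE; auto.
  - apply prv_eqI.
  - eapply prv_eqE; eauto.
Qed.

(* Instances of the variables are introduced one at a time; those already in
   place are lifted so that the remaining instantiations bring them back. *)
Lemma prv_instances T p f g k j :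
  prv T [] p ->
  prv T [] (subst (fun n => if n <? k then lift j (f n) else Var (n - k))
                  (fun X => X) p) /\
  prv T [] (subst Var (fun X => if X <? k then j + g X else X - k) p).
Proof.
  intros Hp; revert j; induction k as [|k IH]; intros j.
  - split; (replace (subst _ _ p) with p; [exact Hp|]);
      rewrite <- subst_id at 1; apply subst_ext; intros n; simpl;
      now rewrite ?Nat.sub_0_r.
  - destruct (IH (S j)) as [H1 H2]; split.
    + assert (H := prv_allNE T [] _ (lift j (f k)) (prv_allNI T [] _ H1)).
      unfold instN in H; rewrite subst_comp in H.
      erewrite subst_ext; [exact H| |reflexivity].
      intros n; simpl; destruct (Nat.ltb_spec n (S k)), (Nat.ltb_spec n k); try lia.
      * unfold lift; rewrite tsubst_comp; now apply tsubst_ext.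
      * replace (n - k) with 0 by lia; simpl; do 2 f_equal; lia.
      * replace (n - k) with (S (n - S k)) by lia; reflexivity.
    + assert (H := prv_allSE T [] _ (j + g k) (prv_allSI T [] _ H2)).
      unfold instS in H; rewrite subst_comp in H.
      erewrite subst_ext; [exact H|reflexivity|].
      intros n; simpl; destruct (Nat.ltb_spec n (S k)), (Nat.ltb_spec n k); try lia.
      * reflexivity.
      * replace (n - k) with 0 by lia; simpl; do 2 f_equal; lia.
      * replace (n - k) with (S (n - S k)) by lia; reflexivity.
Qed.

(** An axiom may have free variables, and [prv_ax] gives it only as written. Its instances come from
    generalizing over an empty context and then instantiating, number variables first; from
    [nbound p] and [sbound q] upwards no variable is left to treat. *)
Lemma prv_subst_closed T p f g : prv T [] p -> prv T [] (subst f g p).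
Proof.
  intros Hp.
  assert (H1 : prv T [] (subst f (fun X => X) p)).
  { destruct (prv_instances T p f g (nbound p) 0 Hp) as [H _].
    erewrite subst_bound; [exact H| |reflexivity].
    intros n Hn; simpl; apply Nat.ltb_lt in Hn; rewrite Hn.
    symmetry; apply tsubst_id. }
  set (q := subst f (fun X => X) p) in *.
  destruct (prv_instances T q f g (sbound q) 0 H1) as [_ H].
  replace (subst f g p) with (subst Var g q).
  - erewrite subst_bound; [exact H|reflexivity|].
    intros n Hn; simpl; apply Nat.ltb_lt in Hn; now rewrite Hn.
  - unfold q; rewrite subst_comp; apply subst_ext; trivial.
    intros n; apply tsubst_id.
Qed.

Lemma prv_subst T G p f g :
  prv T G p -> prv T (map (subst f g) G) (subst f g p).
Proof.
  intros H; revert f g; induction H; intros f g; simpl.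
  - apply prv_weaken with []; [|easy]. now apply prv_subst_closed, prv_ax.
  - now apply prv_hyp, in_map.
  - apply prv_impI, IHprv.
  - eapply prv_impE; [apply IHprv1|apply IHprv2].
  - apply prv_raa, IHprv.
  - apply prv_allNI. specialize (IHprv (upN f) g).
    rewrite map_map in *; erewrite map_ext; [exact IHprv|].
    intros a; symmetry; apply shiftN_subst.
  - rewrite instN_subst; apply prv_allNE, IHprv.
  - apply prv_allSI. specialize (IHprv f (upS g)).
    rewrite map_map in *; erewrite map_ext; [exact IHprv|].
    intros a; symmetry; apply shiftS_subst.
  - rewrite instS_subst; apply prv_allSE, IHprv.
  - apply prv_eqI.
  - rewrite instN_subst in *; eapply prv_eqE; [apply IHprv1|].
    specialize (IHprv2 f g); now rewrite instN_subst in IHprv2.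
Qed.

Lemma prv_fresh_allN T G p k :
  (forall q, In q (p :: G) -> nbound q <= k) ->
  prv T G (instN (Var k) p) -> prv T G (AllN p).
Proof.
  intros Hk H; apply prv_allNI.
  apply prv_subst with (f := fun n => if n =? k then Var 0 else Var (S n))
                       (g := fun X => X) in H.
  replace (map shiftN G) with
    (map (subst (fun n => if n =? k then Var 0 else Var (S n)) (fun X => X)) G).
  - unfold instN in H; rewrite subst_comp in H.
    erewrite <- subst_id, subst_bound; [exact H| |reflexivity].
    intros [|n] Hn; simpl.
    + now rewrite Nat.eqb_refl.
    + specialize (Hk p (or_introl eq_refl)).
      destruct (Nat.eqb_spec n k); [lia|reflexivity].
  - apply map_ext_in; intros q Hq; apply subst_bound; trivial.
    intros n Hn; specialize (Hk q (or_intror Hq)).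
    destruct (Nat.eqb_spec n k); [lia|reflexivity].
Qed.

Lemma prv_fresh_allS T G p k :
  (forall q, In q (p :: G) -> sbound q <= k) ->
  prv T G (instS k p) -> prv T G (AllS p).
Proof.
  intros Hk H; apply prv_allSI.
  apply prv_subst with (g := fun n => if n =? k then 0 else S n)
                       (f := Var) in H.
  replace (map shiftS G) with
    (map (subst Var (fun n => if n =? k then 0 else S n)) G).
  - unfold instS in H; rewrite subst_comp in H.
    erewrite <- subst_id, subst_bound; [exact H|reflexivity|].
    intros [|n] Hn; simpl.
    + now rewrite Nat.eqb_refl.
    + specialize (Hk p (or_introl eq_refl)).
      destruct (Nat.eqb_spec n k); [lia|reflexivity].
  - apply map_ext_in; intros q Hq; apply subst_bound; trivial.
    intros n Hn; specialize (Hk q (or_intror Hq)).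
    destruct (Nat.eqb_spec n k); [lia|reflexivity].
Qed.

(** * Completeness *)

Local Opaque to_nat.

Fixpoint tcode (t : term) : nat :=
  match t with
  | Var n => to_nat (0, n)
  | Zero => to_nat (1, 0)
  | One => to_nat (2, 0)
  | Add s t => to_nat (3, to_nat (tcode s, tcode t))
  | Mul s t => to_nat (4, to_nat (tcode s, tcode t))
  end.

Fixpoint fcode (p : form) : nat :=
  match p with
  | Eq s t => to_nat (0, to_nat (tcode s, tcode t))
  | Lt s t => to_nat (1, to_nat (tcode s, tcode t))
  | Mem t X => to_nat (2, to_nat (tcode t, X))
  | Bot => to_nat (3, 0)
  | Imp p q => to_nat (4, to_nat (fcode p, fcode q))
  | AllN p => to_nat (5, fcode p)
  | AllS p => to_nat (6, fcode p)
  end.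

Ltac code_inj :=
  repeat match goal with
    | H : to_nat _ = to_nat _ |- _ => apply to_nat_inj in H
    | H : (_, _) = (_, _) |- _ => apply pair_equal_spec in H; destruct H
    end.

Lemma tcode_inj s t : tcode s = tcode t -> s = t.
Proof.
  revert t; induction s; intros [] H; cbn -[to_nat] in H; code_inj;
    try discriminate; subst; f_equal; auto.
Qed.

Lemma fcode_inj p q : fcode p = fcode q -> p = q.
Proof.
  revert q; induction p; intros [] H; cbn -[to_nat] in H; code_inj;
    try discriminate; subst; f_equal; auto using tcode_inj.
Qed.

(** * Structures and satisfaction *)

Record structure := {
  num : Type;
  sets : Type;
  zero : num;
  one : num;
  add : num -> num -> num;
  mul : num -> num -> num;
  lt : num -> num -> Prop;
  mem : num -> sets -> Prop
}.

Fixpoint eval (A : structure) (r : nat -> num A) (t : term) : num A :=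
  match t with
  | Var n => r n
  | Zero => zero A
  | One => one A
  | Add s t => add A (eval A r s) (eval A r t)
  | Mul s t => mul A (eval A r s) (eval A r t)
  end.

Fixpoint sat (A : structure) (r : nat -> num A) (v : nat -> sets A) (p : form) : Prop :=
  match p with
  | Eq s t => eval A r s = eval A r t
  | Lt s t => lt A (eval A r s) (eval A r t)
  | Mem t X => mem A (eval A r t) (v X)
  | Bot => False
  | Imp p q => sat A r v p -> sat A r v q
  | AllN p => forall x, sat A (scons x r) v p
  | AllS p => forall X, sat A r (scons X v) p
  end.

Definition models (A : structure) (T : form -> Prop) : Prop :=
  forall p, T p -> forall r v, sat A r v p.

(** * The Henkin construction *)

Section Henkin.

Context (T : form -> Prop) (G0 : list form) (con : ~ prv T G0 Bot).

Definition fresh (G : list form) : nat :=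
  list_max (map (fun p => Nat.max (nbound p) (sbound p)) G).

Lemma fresh_spec G p : In p G -> nbound p <= fresh G /\ sbound p <= fresh G.
Proof.
  intros H.
  assert (E := proj1 (list_max_le _ _) (le_n (fresh G))).
  rewrite Forall_forall in E.
  specialize (E _ (in_map (fun p => Nat.max (nbound p) (sbound p)) _ _ H)).
  simpl in E; lia.
Qed.

(** An accepted negation of a universal formula brings its counterexample along. No other shape
    needs a witness, as existential quantifiers abbreviate such negations. *)
Definition extend (p : form) (G : list form) : list form :=
  if excluded_middle_informative (prv T (p :: G) Bot) then G
  else match p with
       | Imp (AllN q) Bot => Neg (instN (Var (fresh (q :: p :: G))) q) :: p :: G
       | Imp (AllS q) Bot => Neg (instS (fresh (q :: p :: G)) q) :: p :: G
       | _ => p :: G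
       end.

Lemma extend_consistent p G : ~ prv T G Bot -> ~ prv T (extend p G) Bot.
Proof.
  intros HG; unfold extend; destruct excluded_middle_informative as [|Hp]; trivial.
  destruct p as [| | | |p q| |]; trivial.
  destruct p; trivial; destruct q; trivial; intros H; apply Hp; clear Hp.
  - eapply prv_impE; [apply prv_hyp; left; reflexivity|].
    eapply prv_fresh_allN; [|apply prv_raa; exact H].
    intros q Hq; now apply fresh_spec.
  - eapply prv_impE; [apply prv_hyp; left; reflexivity|].
    eapply prv_fresh_allS; [|apply prv_raa; exact H].
    intros q Hq; now apply fresh_spec.
Qed.

Lemma extend_incl p G : incl G (extend p G).
Proof.
  unfold extend; destruct excluded_middle_informative; [apply incl_refl|].
  destruct p as [| | | |p q| |]; try (intros x Hx; simpl; tauto).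
  destruct p; try (intros x Hx; simpl; tauto);
    destruct q; intros x Hx; simpl; tauto.
Qed.

Fixpoint stage (n : nat) : list form :=
  match n with
  | 0 => G0
  | S n =>
      match excluded_middle_informative (exists p, fcode p = n) with
      | left e =>
          extend (proj1_sig (constructive_indefinite_description _ e)) (stage n)
      | right _ => stage n
      end
  end.

Lemma stage_fcode p : stage (S (fcode p)) = extend p (stage (fcode p)).
Proof.
  simpl; destruct excluded_middle_informative as [e|e].
  - destruct constructive_indefinite_description as [q Hq]; simpl.
    now apply fcode_inj in Hq; subst.
  - destruct e; eauto.
Qed.

Lemma stage_consistent n : ~ prv T (stage n) Bot.
Proof.
  induction n as [|n IH]; simpl; trivial.
  destruct excluded_middle_informative; trivial.
  now apply extend_consistent.
Qed.

Lemma stage_incl n m : n <= m -> incl (stage n) (stage m).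
Proof.
  induction 1 as [|m _ IH]; [apply incl_refl|].
  eapply incl_tran; [exact IH|]; simpl.
  destruct excluded_middle_informative; [apply extend_incl|apply incl_refl].
Qed.

Definition henkin (p : form) : Prop := exists n, In p (stage n).

(** The formula is examined at stage [fcode p]. Had it been rejected there, a stage above both [n]
    and [fcode p] would prove and refute it. *)
Lemma henkin_stage p n : prv T (stage n) p -> henkin p.
Proof.
  intros Hp; exists (S (fcode p)); rewrite stage_fcode; unfold extend.
  destruct excluded_middle_informative as [H|_].
  - exfalso; apply (stage_consistent (Nat.max n (fcode p))).
    eapply prv_impE with p.
    + apply prv_impI; eapply prv_weaken; [exact H|].
      intros x [->|Hx]; [now left|right].
      eapply stage_incl; [|exact Hx]; lia.
    + eapply prv_weaken; [exact Hp|]; apply stage_incl; lia.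
  - destruct p as [| | | |p q| |]; try (simpl; tauto).
    destruct p; try (simpl; tauto); destruct q; simpl; tauto.
Qed.

Lemma henkin_list G : (forall p, In p G -> henkin p) -> exists n, incl G (stage n).
Proof.
  induction G as [|p G IH]; intros H; [exists 0; easy|].
  destruct IH as [n Hn]; [intros; apply H; now right|].
  destruct (H p) as [m Hm]; [now left|].
  exists (Nat.max n m); intros x [->|Hx].
  - eapply stage_incl; [|exact Hm]; lia.
  - eapply stage_incl; [|apply Hn, Hx]; lia.
Qed.

Lemma henkin_prv G p : (forall q, In q G -> henkin q) -> prv T G p -> henkin p.
Proof.
  intros HG Hp; destruct (henkin_list G HG) as [n Hn].
  apply henkin_stage with n; eapply prv_weaken; eauto.
Qed.

Lemma henkin_Bot : ~ henkin Bot.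
Proof. intros [n Hn]; apply (stage_consistent n), prv_hyp, Hn. Qed.

Lemma henkin_mp p q : henkin (Imp p q) -> henkin p -> henkin q.
Proof.
  intros H1 H2; apply henkin_prv with [Imp p q; p].
  - intros x [<-|[<-|[]]]; trivial.
  - eapply prv_impE; apply prv_hyp; simpl; auto.
Qed.

Lemma extend_head p G :
  ~ prv T (p :: G) Bot -> In p (extend p G).
Proof.
  intros H; unfold extend; destruct excluded_middle_informative; [contradiction|].
  destruct p as [| | | |p q| |]; try (simpl; tauto).
  destruct p; try (simpl; tauto); destruct q; simpl; tauto.
Qed.

Lemma henkin_Imp p q : henkin (Imp p q) <-> (henkin p -> henkin q).
Proof.
  split; [apply henkin_mp|]; intros H.
  destruct (classic (prv T (p :: stage (fcode p)) Bot)) as [Hp|Hp].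
  (* A rejected [p] is refuted by its stage, which therefore proves [Imp p q] for any [q]. *)
  - apply henkin_stage with (fcode p), prv_impI, prv_raa.
    eapply prv_weaken; [exact Hp|]; intros x [->|Hx]; simpl; auto.
  - apply henkin_prv with [q].
    + intros x [<-|[]]; apply H; exists (S (fcode p)).
      rewrite stage_fcode; now apply extend_head.
    + apply prv_impI, prv_hyp; simpl; auto.
Qed.

Lemma henkin_neg p : ~ henkin p -> henkin (Neg p).
Proof. intros H; apply henkin_Imp; intros Hp; contradiction. Qed.

Lemma henkin_extend p q : In q (extend p (stage (fcode p))) -> henkin q.
Proof. intros Hq; exists (S (fcode p)); now rewrite stage_fcode. Qed.

Lemma henkin_consistent p G :
  henkin p -> (exists n, incl G (stage n)) -> ~ prv T (p :: G) Bot.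
Proof.
  intros Hp [n Hn] H; apply henkin_Bot, henkin_prv with (p :: G); trivial.
  intros q [<-|Hq]; trivial; exists n; auto.
Qed.

Lemma henkin_AllN p : henkin (AllN p) <-> forall t, henkin (instN t p).
Proof.
  split.
  - intros H t; apply henkin_prv with [AllN p].
    + intros x [<-|[]]; trivial.
    + apply prv_allNE, prv_hyp; now left.
  - intros H; apply NNPP; intros Hn; apply henkin_neg in Hn.
    set (G := stage (fcode (Neg (AllN p)))).
    (* [Neg (AllN p)] is accepted at its own stage, where [extend] adds the negated instance at
       exactly this variable. *)
    apply henkin_Bot, henkin_mp with (instN (Var (fresh (p :: Neg (AllN p) :: G))) p);
      [|apply H].
    apply henkin_extend with (Neg (AllN p)).
    unfold extend; destruct excluded_middle_informative as [e|e].
    + exfalso; revert e; apply henkin_consistent; [exact Hn|].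
      eexists; apply incl_refl.
    + left; reflexivity.
Qed.

Lemma henkin_AllS p : henkin (AllS p) <-> forall X, henkin (instS X p).
Proof.
  split.
  - intros H t; apply henkin_prv with [AllS p].
    + intros x [<-|[]]; trivial.
    + apply prv_allSE, prv_hyp; now left.
  - intros H; apply NNPP; intros Hn; apply henkin_neg in Hn.
    set (G := stage (fcode (Neg (AllS p)))).
    apply henkin_Bot, henkin_mp with (instS (fresh (p :: Neg (AllS p) :: G)) p);
      [|apply H].
    apply henkin_extend with (Neg (AllS p)).
    unfold extend; destruct excluded_middle_informative as [e|e].
    + exfalso; revert e; apply henkin_consistent; [exact Hn|].
      eexists; apply incl_refl.
    + left; reflexivity.
Qed.

(** * Equality and the term model *)

Lemma henkin_refl t : henkin (Eq t t).
Proof. apply henkin_prv with []; [easy|apply prv_eqI]. Qed.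

Lemma henkin_eqE s t p : henkin (Eq s t) -> henkin (instN s p) -> henkin (instN t p).
Proof.
  intros H1 H2; apply henkin_prv with [Eq s t; instN s p].
  - intros x [<-|[<-|[]]]; trivial.
  - apply prv_eqE with s; apply prv_hyp; simpl; auto.
Qed.

Lemma tsubst_lift1 s t : tsubst (scons s Var) (lift 1 t) = t.
Proof. unfold lift; rewrite tsubst_comp; apply tsubst_id. Qed.

Lemma henkin_sym s t : henkin (Eq s t) -> henkin (Eq t s).
Proof.
  intros H; generalize (henkin_eqE s t (Eq (Var 0) (lift 1 s)) H).
  unfold instN; simpl; rewrite tsubst_lift1, tsubst_lift1.
  intros E; apply E, henkin_refl.
Qed.

Lemma henkin_trans s t u : henkin (Eq s t) -> henkin (Eq t u) -> henkin (Eq s u).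
Proof.
  intros H1 H2; generalize (henkin_eqE t u (Eq (lift 1 s) (Var 0)) H2).
  unfold instN; simpl; rewrite !tsubst_lift1; auto.
Qed.

(** Classes of terms are taken as predicates, so that by extensionality their equality is Rocq's
    own, which [sat] uses for [Eq]. Sets need no quotient, since the language has no equality
    between sets. *)
Definition elem : Type := {P : term -> Prop | exists t, P = fun s => henkin (Eq t s)}.

Definition cls (t : term) : elem :=
  exist _ (fun s => henkin (Eq t s)) (ex_intro _ t eq_refl).

Lemma cls_eq s t : cls s = cls t <-> henkin (Eq s t).
Proof.
  split.
  - intros H; injection H; intros E.
    rewrite (f_equal (fun P => P t) E); apply henkin_refl.
  - intros H; apply subset_eq_compat.
    apply functional_extensionality; intros u; apply propositional_extensionality.
    split; intros; eauto using henkin_trans, henkin_sym.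
Qed.

Lemma cls_surj (x : elem) : exists t, cls t = x.
Proof.
  destruct x as [P [t ->]]; exists t; now apply subset_eq_compat.
Qed.

Definition rep (x : elem) : term :=
  proj1_sig (constructive_indefinite_description _ (cls_surj x)).

Lemma cls_rep x : cls (rep x) = x.
Proof. unfold rep; now destruct constructive_indefinite_description. Qed.

Lemma rep_cls t : henkin (Eq (rep (cls t)) t).
Proof. apply cls_eq, cls_rep. Qed.

Definition term_model : structure := {|
  num := elem;
  sets := nat;
  zero := cls Zero;
  one := cls One;
  add x y := cls (Add (rep x) (rep y));
  mul x y := cls (Mul (rep x) (rep y));
  lt x y := henkin (Lt (rep x) (rep y));
  mem x X := henkin (Mem (rep x) X)
|}.

Lemma henkin_congr2 (op : term -> term -> form) s s' t t' :
  (forall f g u v, subst f g (op u v) = op (tsubst f u) (tsubst f v)) ->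
  henkin (Eq s s') -> henkin (Eq t t') -> henkin (op s t) -> henkin (op s' t').
Proof.
  intros Hop Hs Ht H.
  assert (E := henkin_eqE s s' (op (Var 0) (lift 1 t)) Hs).
  unfold instN in E; rewrite !Hop, !tsubst_lift1 in E.
  assert (F := henkin_eqE t t' (op (lift 1 s') (Var 0)) Ht).
  unfold instN in F; rewrite !Hop, !tsubst_lift1 in F.
  auto.
Qed.

Lemma cls_op (op : term -> term -> term) s t :
  (forall f u v, tsubst f (op u v) = op (tsubst f u) (tsubst f v)) ->
  cls (op (rep (cls s)) (rep (cls t))) = cls (op s t).
Proof.
  intros Hop; apply cls_eq.
  set (a := rep (cls s)) in *; set (b := rep (cls t)) in *.
  assert (E1 := henkin_eqE a s (Eq (lift 1 (op a b)) (op (Var 0) (lift 1 b))) (rep_cls s)).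
  unfold instN in E1; simpl in E1; rewrite !Hop in E1; simpl in E1;
    rewrite !tsubst_lift1 in E1.
  assert (E2 := henkin_eqE b t (Eq (lift 1 (op a b)) (op (lift 1 s) (Var 0))) (rep_cls t)).
  unfold instN in E2; simpl in E2; rewrite !Hop in E2; simpl in E2;
    rewrite !tsubst_lift1 in E2.
  apply E2, E1, henkin_refl.
Qed.

Lemma eval_cls f t : eval term_model (fun n => cls (f n)) t = cls (tsubst f t).
Proof.
  induction t; simpl; trivial; rewrite IHt1, IHt2.
  - now apply (cls_op Add).
  - now apply (cls_op Mul).
Qed.

Lemma scons_cls t f : scons (cls t) (fun n => cls (f n)) = fun n => cls (scons t f n).
Proof. apply functional_extensionality; now intros [|n]. Qed.

Lemma truth p f g :
  sat term_model (fun n => cls (f n)) g p <-> henkin (subst f g p).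
Proof.
  revert f g; induction p; intros f g; cbn -[term_model]; rewrite ?eval_cls.
  - apply cls_eq.
  - simpl; split; (apply (henkin_congr2 Lt); [reflexivity| |]);
      auto using rep_cls, henkin_sym.
  - simpl; split; intros H;
      [eapply henkin_eqE with (p := Mem (Var 0) (g X)); [apply rep_cls|]
      |eapply henkin_eqE with (p := Mem (Var 0) (g X)); [apply henkin_sym, rep_cls|]];
      exact H.
  - split; [easy|apply henkin_Bot].
  - rewrite IHp1, IHp2; symmetry; apply henkin_Imp.
  - fold (upN f); rewrite henkin_AllN; split.
    + intros H t; rewrite instN_upN, <- IHp, <- scons_cls; apply H.
    + intros H x; destruct (cls_surj x) as [t <-].
      rewrite scons_cls, IHp, <- instN_upN; apply H.
  - fold (upS g); rewrite henkin_AllS; split.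
    + intros H X; rewrite instS_upS, <- IHp; apply H.
    + intros H X; rewrite IHp, <- instS_upS; apply H.
Qed.

Lemma term_model_models : models term_model T.
Proof.
  intros p Hp r v.
  replace r with (fun n => cls (rep (r n)))
    by (apply functional_extensionality; intros; apply cls_rep).
  apply truth, henkin_prv with []; [easy|].
  now apply prv_subst_closed, prv_ax.
Qed.

End Henkin.

(** The countermodel is the term model with each number variable assigned its own class, so only
    models whose elements are all named have to be considered. This restriction is what later allows
    arbitrary parameters in induction and comprehension. *)
Theorem completeness T p :
  (forall (A : structure) (r : nat -> num A) (v : nat -> sets A),
      models A T -> (forall x, exists t, eval A r t = x) ->
      (forall X, exists i, v i = X) -> sat A r v p) ->
  prv T [] p.
Proof.
  intros H; apply prv_raa, NNPP; intros con.
  apply (henkin_Bot T _ con), henkin_mp with p; trivial.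
  - exists 0; now left.
  - rewrite <- (subst_id p) at 2; apply truth; trivial; apply H.
    + now apply term_model_models.
    + intros x; destruct (cls_surj _ _ x) as [t <-]; exists t.
      rewrite <- (tsubst_id t) at 2; now apply eval_cls.
    + eauto.
Qed.

(** * Satisfaction *)

Lemma forall_iff (X : Type) (P Q : X -> Prop) :
  (forall x, P x <-> Q x) -> (forall x, P x) <-> (forall x, Q x).
Proof. firstorder. Qed.

Lemma exists_iff (X : Type) (P Q : X -> Prop) :
  (forall x, P x <-> Q x) -> (exists x, P x) <-> (exists x, Q x).
Proof. firstorder. Qed.

Lemma and_iff P P' Q Q' : (P <-> P') -> (Q <-> Q') -> (P /\ Q) <-> (P' /\ Q').
Proof. tauto. Qed.

Lemma imp_iff (P P' Q Q' : Prop) : (P <-> P') -> (Q <-> Q') -> (P -> Q) <-> (P' -> Q').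
Proof. tauto. Qed.

Lemma iff_iff P P' Q Q' : (P <-> P') -> (Q <-> Q') -> (P <-> Q) <-> (P' <-> Q').
Proof. tauto. Qed.

Lemma eval_tsubst A r f t :
  eval A r (tsubst f t) = eval A (fun n => eval A r (f n)) t.
Proof. induction t; simpl; congruence. Qed.

Lemma eval_lift1 A r x t : eval A (scons x r) (lift 1 t) = eval A r t.
Proof. apply eval_tsubst. Qed.

Lemma sat_subst A r v f g p :
  sat A r v (subst f g p) <->
  sat A (fun n => eval A r (f n)) (fun X => v (g X)) p.
Proof.
  revert r v f g; induction p; intros; simpl; rewrite ?eval_tsubst; try tauto.
  - rewrite IHp1, IHp2; tauto.
  - apply forall_iff; intros x; rewrite IHp.
    match goal with |- sat _ ?r _ _ <-> sat _ ?r' _ _ => replace r with r' end.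
    + reflexivity.
    + apply functional_extensionality; intros [|n]; simpl; trivial.
      symmetry; apply eval_lift1.
  - apply forall_iff; intros X; rewrite IHp.
    match goal with |- sat _ _ ?r _ <-> sat _ _ ?r' _ => replace r with r' end.
    + reflexivity.
    + apply functional_extensionality; now intros [|n].
Qed.

Section Connectives.

Context (A : structure) (r : nat -> num A) (v : nat -> sets A).

Lemma sat_AllN p : sat A r v (AllN p) <-> forall x, sat A (scons x r) v p.
Proof. reflexivity. Qed.

Lemma sat_AllS p : sat A r v (AllS p) <-> forall X, sat A r (scons X v) p.
Proof. reflexivity. Qed.

Lemma sat_Imp p q : sat A r v (Imp p q) <-> (sat A r v p -> sat A r v q).
Proof. reflexivity. Qed.

Lemma sat_Neg p : sat A r v (Neg p) <-> ~ sat A r v p.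
Proof. reflexivity. Qed.

Lemma sat_And p q : sat A r v (And p q) <-> sat A r v p /\ sat A r v q.
Proof. simpl; tauto. Qed.

Lemma sat_Or p q : sat A r v (Or p q) <-> sat A r v p \/ sat A r v q.
Proof. simpl; tauto. Qed.

Lemma sat_Iff p q : sat A r v (Iff p q) <-> (sat A r v p <-> sat A r v q).
Proof. simpl; tauto. Qed.

Lemma sat_ExN p : sat A r v (ExN p) <-> exists x, sat A (scons x r) v p.
Proof.
  simpl; split.
  - intros H; apply NNPP; intros Hn; apply H; intros x Hx; apply Hn; eauto.
  - intros [x Hx] H; now apply (H x).
Qed.

Lemma sat_ExS p : sat A r v (ExS p) <-> exists X, sat A r (scons X v) p.
Proof.
  simpl; split.
  - intros H; apply NNPP; intros Hn; apply H; intros x Hx; apply Hn; eauto.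
  - intros [x Hx] H; now apply (H x).
Qed.

End Connectives.

(** * Definability and arithmetic in a model of [RCA0] *)

Declare Scope num_scope.
Delimit Scope num_scope with num.

Section Model.

Context (A : structure) (r0 : nat -> num A) (v0 : nat -> sets A).
Context (HA : models A RCA0).
Context (num_named : forall x, exists t, eval A r0 t = x).
Context (sets_named : forall X, exists i, v0 i = X).

Local Notation "0" := (zero A) : num_scope.
Local Notation "1" := (one A) : num_scope.
Local Notation "x + y" := (add A x y) : num_scope.
Local Notation "x * y" := (mul A x y) : num_scope.
Local Notation "x < y" := (lt A x y) : num_scope.
Local Open Scope num_scope.

(* [agree k r]: the assignment r has k local variables on top of r0; as r0 names
   all of the model, [tdef] and [def] admit arbitrary parameters. *)
Definition agree (k : nat) (r : nat -> num A) : Prop :=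
  forall n, r (k + n)%nat = r0 n.

Definition tdef (k : nat) (t : (nat -> num A) -> num A) : Prop :=
  exists u, forall r, agree k r -> eval A r u = t r.

Definition def (k : nat) (P : (nat -> num A) -> Prop) : Prop :=
  exists p, bounded p /\ forall r, agree k r -> (sat A r v0 p <-> P r).

(** Quantifying over all contexts [k] and terms [t] lets an abstract [P] occur below quantifiers
    without a substitution lemma for bounded formulas. *)
Definition definable (P : num A -> Prop) : Prop :=
  forall k t, tdef k t -> def k (fun r => P (t r)).

Lemma tdef_var k n : tdef k (fun r => r n).
Proof. now exists (Var n). Qed.

Lemma tdef_const k c : tdef k (fun _ => c).
Proof.
  destruct (num_named c) as [t Ht]; exists (lift k t); intros r Hr.
  unfold lift; rewrite eval_tsubst, <- Ht; simpl; f_equal.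
  apply functional_extensionality, Hr.
Qed.

Lemma tdef_add k s t : tdef k s -> tdef k t -> tdef k (fun r => s r + t r).
Proof.
  intros [a Ha] [b Hb]; exists (Add a b); intros r Hr; simpl.
  now rewrite Ha, Hb.
Qed.

Lemma tdef_mul k s t : tdef k s -> tdef k t -> tdef k (fun r => s r * t r).
Proof.
  intros [a Ha] [b Hb]; exists (Mul a b); intros r Hr; simpl.
  now rewrite Ha, Hb.
Qed.

Lemma tdef_shift k t : tdef k t -> tdef (S k) (fun r => t (fun n => r (S n))).
Proof.
  intros [u Hu]; exists (lift 1 u); intros r Hr.
  unfold lift; rewrite eval_tsubst; now apply Hu.
Qed.

Lemma def_iff k P Q : (forall r, P r <-> Q r) -> def k P -> def k Q.
Proof.
  intros E [p [Hp H]]; exists p; split; trivial.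
  intros r Hr; rewrite <- E; auto.
Qed.

Lemma def_eq k s t : tdef k s -> tdef k t -> def k (fun r => s r = t r).
Proof.
  intros [a Ha] [b Hb]; exists (Eq a b); split; [constructor|].
  intros r Hr; simpl; rewrite Ha, Hb; tauto.
Qed.

Lemma def_lt k s t : tdef k s -> tdef k t -> def k (fun r => s r < t r).
Proof.
  intros [a Ha] [b Hb]; exists (Lt a b); split; [constructor|].
  intros r Hr; simpl; rewrite Ha, Hb; tauto.
Qed.

Lemma def_mem k t X : tdef k t -> def k (fun r => mem A (t r) X).
Proof.
  intros [a Ha]; destruct (sets_named X) as [i <-].
  exists (Mem a i); split; [constructor|].
  intros r Hr; simpl; rewrite Ha; tauto.
Qed.

Lemma def_imp k P Q : def k P -> def k Q -> def k (fun r => P r -> Q r).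
Proof.
  intros [p [Bp Hp]] [q [Bq Hq]]; exists (Imp p q); split; [now constructor|].
  intros r Hr; simpl; rewrite Hp, Hq; tauto.
Qed.

Lemma def_False k : def k (fun _ => False).
Proof. exists Bot; split; [constructor|]; simpl; tauto. Qed.

Lemma def_not k P : def k P -> def k (fun r => ~ P r).
Proof. intros H; apply def_imp; trivial; apply def_False. Qed.

Lemma def_and k P Q : def k P -> def k Q -> def k (fun r => P r /\ Q r).
Proof.
  intros HP HQ; apply def_iff with (fun r => ~ (P r -> ~ Q r)).
  - intros r; tauto.
  - now apply def_not, def_imp, def_not.
Qed.

Lemma def_or k P Q : def k P -> def k Q -> def k (fun r => P r \/ Q r).
Proof.
  intros HP HQ; apply def_iff with (fun r => ~ P r -> Q r).
  - intros r; tauto.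
  - apply def_imp; trivial; now apply def_not.
Qed.

Lemma def_equiv k P Q : def k P -> def k Q -> def k (fun r => P r <-> Q r).
Proof. intros HP HQ; now apply def_and; apply def_imp. Qed.

Lemma def_all k t Q :
  tdef k t -> def (S k) (fun r => Q (fun n => r (S n)) (r O)) ->
  def k (fun r => forall x, x < t r -> Q r x).
Proof.
  intros [a Ha] [p [Bp Hp]]; exists (AllN (Imp (Lt (Var 0) (lift 1 a)) p)).
  split; [now constructor|].
  intros r Hr; simpl; apply forall_iff; intros x.
  rewrite eval_lift1, Ha, Hp; trivial; simpl; tauto.
Qed.

Lemma def_ex k t Q :
  tdef k t -> def (S k) (fun r => Q (fun n => r (S n)) (r O)) ->
  def k (fun r => exists x, x < t r /\ Q r x).
Proof.
  intros Ht HQ; apply def_iff with (fun r => ~ forall x, x < t r -> ~ Q r x).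
  - intros r; split.
    + intros H; apply NNPP; intros Hn; apply H; intros x Hx Hq; apply Hn; eauto.
    + intros [x [Hx Hq]] H; now apply (H x).
  - apply def_not, (def_all k t (fun r x => ~ Q r x)); trivial.
    now apply (def_not (S k)).
Qed.

(** Recovers a bounded formula from the shape of a Rocq proposition. Elements of the model occurring
    in it become parameters, through [tdef_const] and [def_mem]. *)
Ltac dstep :=
  cbv beta;
  lazymatch goal with
  | |- tdef _ (fun r => r _) => apply tdef_var
  | |- tdef _ (fun r => @?s r + @?t r) => apply (tdef_add _ s t)
  | |- tdef _ (fun r => @?s r * @?t r) => apply (tdef_mul _ s t)
  | |- tdef (S ?k) (fun r => ?t (fun n => r (S (@?f n)))) =>
      apply (tdef_shift k (fun r => t (fun n => r (f n))))
  | |- tdef _ (fun _ => ?c) => apply (tdef_const _ c)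
  | |- def _ (fun r => forall x, x < @?t r -> @?Q r x) => apply (def_all _ t Q)
  | |- def _ (fun r => exists x, x < @?t r /\ @?Q r x) => apply (def_ex _ t Q)
  | |- def _ (fun r => @?P r <-> @?Q r) => apply (def_equiv _ P Q)
  | |- def _ (fun r => @?P r /\ @?Q r) => apply (def_and _ P Q)
  | |- def _ (fun r => @?P r \/ @?Q r) => apply (def_or _ P Q)
  | |- def _ (fun r => ~ @?P r) => apply (def_not _ P)
  | |- def _ (fun r => @?s r = @?t r) => apply (def_eq _ s t)
  | |- def _ (fun r => @?s r < @?t r) => apply (def_lt _ s t)
  | |- def _ (fun r => mem A (@?t r) ?X) => apply (def_mem _ t X)
  | |- def _ (fun r => @?P r -> @?Q r) => apply (def_imp _ P Q)
  | H : definable ?P |- def _ (fun r => ?P (@?t r)) => apply (H _ t)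
  | |- _ => assumption
  end.
Ltac def_auto := repeat dstep.

(** * Induction and comprehension for definable predicates *)

Lemma agree_2 x y : agree 2 (scons y (scons x r0)).
Proof. easy. Qed.

(** Of the two local variables, index 1 is the induction variable and index 0 the witness, bound by
    the leading quantifier of the Sigma_1 formula. *)
Lemma sigma1_induction (Q : num A -> num A -> Prop) :
  def 2 (fun r => Q (r 1%nat) (r O)) ->
  (exists y, Q 0 y) ->
  (forall x, (exists y, Q x y) -> exists y, Q (x + 1) y) ->
  forall x, exists y, Q x y.
Proof.
  intros [p [Bp Hp]] H0 HS.
  assert (E : forall x, sat A (scons x r0) v0 (ExN p) <-> exists y, Q x y).
  { intros x; rewrite sat_ExN; split; intros [y Hy]; exists y;
      now apply (Hp _ (agree_2 x y)). }
  assert (I := HA _ (RCA0_Sigma1_ind _ (Sigma1_intro p Bp)) r0 v0).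
  unfold induction_for in I; change (sat A r0 v0 (AllN (ExN p))) with
    (forall x, sat A (scons x r0) v0 (ExN p)) in I.
  intros x; rewrite <- E; apply I; clear I x.
  apply sat_And; split.
  - unfold instN; rewrite sat_subst.
    replace (fun n => eval A r0 (scons Zero Var n)) with (scons 0 r0)
      by (apply functional_extensionality; now intros [|n]).
    now apply E.
  - intros x Hx; apply sat_subst.
    replace (fun n => eval A _ _) with (scons (x + 1) r0)
      by (apply functional_extensionality; now intros [|n]).
    now apply E, HS, E.
Qed.

Lemma sigma0_induction (P : num A -> Prop) :
  def 2 (fun r => P (r 1%nat)) ->
  P 0 -> (forall x, P x -> P (x + 1)) -> forall x, P x.
Proof.
  intros D H0 HS x; destruct (sigma1_induction (fun x _ => P x) D) with x; trivial.
  - now exists 0.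
  - intros y [z Hz]; exists z; auto.
Qed.

Lemma comprehension (P : num A -> Prop) (Q Q' : num A -> num A -> Prop) :
  def 2 (fun r => Q (r 1%nat) (r O)) -> def 2 (fun r => Q' (r 1%nat) (r O)) ->
  (forall x, P x <-> exists y, Q x y) -> (forall x, P x <-> forall y, Q' x y) ->
  exists X, forall x, mem A x X <-> P x.
Proof.
  intros [p [Bp Hp]] [q [Bq Hq]] HQ HQ'.
  assert (I := HA _ (RCA0_Delta1_comp _ _ (Sigma1_intro p Bp) (Pi1_intro q Bq)) r0 v0).
  assert (E : forall x, sat A (scons x r0) v0 (ExN p) <-> P x).
  { intros x; rewrite sat_ExN, HQ; split; intros [y Hy]; exists y;
      now apply (Hp _ (agree_2 x y)). }
  unfold comprehension_for in I.
  assert (J : sat A r0 v0 (AllN (Iff (ExN p) (AllN q)))).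
  { intros x; rewrite sat_Iff, E, HQ'; apply forall_iff; intros y.
    symmetry; apply (Hq _ (agree_2 x y)). }
  apply I in J; rewrite sat_ExS in J; destruct J as [X HX]; exists X.
  intros x; rewrite <- E; specialize (HX x); rewrite sat_Iff in HX.
  unfold shiftS in HX; rewrite sat_subst in HX; exact HX.
Qed.

Lemma comprehension0 (P : num A -> Prop) :
  def 2 (fun r => P (r 1%nat)) -> exists X, forall x, mem A x X <-> P x.
Proof.
  intros D; apply (comprehension P (fun x _ => P x) (fun x _ => P x)); trivial;
    intros x; split.
  - intros H; now exists 0.
  - now intros [_ H].
  - auto.
  - intros H; exact (H 0).
Qed.

(** * Semiring laws from the basic axioms *)

Definition env (x y : num A) : nat -> num A := scons x (scons y (fun _ => 0)).

Lemma basic p (x y : num A) : basic_axiom p -> sat A (env x y) v0 p.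
Proof. intros H; now apply HA, RCA0_basic. Qed.

Lemma succ_neq0 x : x + 1 <> 0.
Proof. apply (basic _ x x ax_succ_neq0). Qed.

Lemma succ_inj x y : x + 1 = y + 1 -> x = y.
Proof. apply (basic _ x y ax_succ_inj). Qed.

Lemma add0 x : x + 0 = x.
Proof. apply (basic _ x x ax_add0). Qed.

Lemma addS x y : x + (y + 1) = x + y + 1.
Proof. apply (basic _ x y ax_addS). Qed.

Lemma mul0 x : x * 0 = 0.
Proof. apply (basic _ x x ax_mul0). Qed.

Lemma mulS x y : x * (y + 1) = x * y + x.
Proof. apply (basic _ x y ax_mulS). Qed.

Lemma lt0 x : ~ x < 0.
Proof. apply (basic _ x x ax_lt0). Qed.

Lemma ltS x y : x < y + 1 <-> x < y \/ x = y.
Proof. assert (H := basic _ x y ax_ltS); now rewrite sat_Iff, sat_Or in H. Qed.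

Lemma add0l x : 0 + x = x.
Proof.
  revert x; apply sigma0_induction; [def_auto|apply add0|].
  intros x H; now rewrite addS, H.
Qed.

Lemma addA x y z : x + (y + z) = x + y + z.
Proof.
  revert z; apply sigma0_induction; [def_auto|now rewrite !add0|].
  intros z H; now rewrite !addS, H.
Qed.

Lemma add1l x : 1 + x = x + 1.
Proof.
  revert x; apply sigma0_induction; [def_auto|now rewrite add0, add0l|].
  intros x H; now rewrite addS, H.
Qed.

Lemma addC x y : x + y = y + x.
Proof.
  revert y; apply sigma0_induction; [def_auto|now rewrite add0, add0l|].
  intros y H; now rewrite addS, H, <- addA, <- add1l, addA.
Qed.

Lemma mul0l x : 0 * x = 0.
Proof.
  revert x; apply sigma0_induction; [def_auto|apply mul0|].
  intros x H; now rewrite mulS, H, add0.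
Qed.

Lemma mul1l x : 1 * x = x.
Proof.
  revert x; apply sigma0_induction; [def_auto|apply mul0|].
  intros x H; now rewrite mulS, H.
Qed.

Lemma mulDl x y z : (x + y) * z = x * z + y * z.
Proof.
  revert z; apply sigma0_induction; [def_auto|now rewrite !mul0, add0|].
  intros z H; rewrite !mulS, H, !addA; f_equal.
  now rewrite <- !addA, (addC (y * z) x).
Qed.

Lemma mulC x y : x * y = y * x.
Proof.
  revert y; apply sigma0_induction; [def_auto|now rewrite mul0, mul0l|].
  intros y H; now rewrite mulS, H, mulDl, mul1l.
Qed.

Lemma mulA x y z : x * (y * z) = x * y * z.
Proof.
  revert x; apply sigma0_induction; [def_auto|now rewrite !mul0l|].
  intros x H; now rewrite !mulDl, H, !mul1l.
Qed.

Lemma semiring : semi_ring_theory 0 1 (add A) (mul A) eq.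
Proof.
  constructor; auto using add0l, addC, addA, mul1l, mul0l, mulC, mulA, mulDl.
Qed.

Add Ring num_ring : semiring.

Lemma add_cancel x y z : x + z = y + z -> x = y.
Proof.
  revert z; apply (sigma0_induction (fun z => x + z = y + z -> x = y)); [def_auto| |].
  - now rewrite !add0.
  - intros z H; rewrite !addS; intros E; apply H, succ_inj, E.
Qed.

(** * The order *)

Lemma lt_add x z : x < x + (z + 1).
Proof.
  revert z; apply sigma0_induction; [def_auto| |].
  - rewrite add0l; apply ltS; now right.
  - intros z H; rewrite addS; apply ltS; now left.
Qed.

Lemma lt_iff x y : x < y <-> exists z, y = x + (z + 1).
Proof.
  split; [|intros [z ->]; apply lt_add].
  revert y.
  (* Pulling the witness in front of the implication makes the induction formula Sigma_1. When
     [x < y] fails, the witness 0 serves for [y + 1], whose premise then forces [x = y]. *)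
  assert (H : forall y, exists z, x < y -> y = x + (z + 1)).
  { apply sigma1_induction; [def_auto| |].
    - exists 0; intros H; now apply lt0 in H.
    - intros y [z Hz]; destruct (classic (x < y)) as [Hy|Hy].
      + exists (z + 1); intros _; rewrite Hz; trivial; ring.
      + exists 0; intros H; apply ltS in H as [H| ->]; [contradiction|ring]. }
  intros y Hy; destruct (H y) as [z Hz]; eauto.
Qed.

Lemma zero_or_succ x : x = 0 \/ exists y, x = y + 1.
Proof.
  assert (H : forall x, exists y, x = 0 \/ x = y + 1).
  { apply sigma1_induction; [def_auto| |].
    - exists 0; now left.
    - intros y _; exists y; now right. }
  destruct (H x) as [y [->|E]]; eauto.
Qed.

Lemma lt_irrefl x : ~ x < x.
Proof.
  rewrite lt_iff; intros [z Hz]; apply (succ_neq0 z), (add_cancel _ _ x).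
  rewrite add0l, addC; now symmetry.
Qed.

Lemma lt_trans x y z : x < y -> y < z -> x < z.
Proof.
  rewrite !lt_iff; intros [a ->] [b ->]; exists (a + b + 1); ring.
Qed.

Lemma lt_total x y : x < y \/ x = y \/ y < x.
Proof.
  revert y; apply (sigma0_induction (fun y => x < y \/ x = y \/ y < x)); [def_auto| |].
  - destruct (zero_or_succ x) as [->|[z ->]]; auto.
    right; right; apply lt_iff; exists z; ring.
  - intros y; rewrite ltS; intros [H|[H|H]]; auto.
    apply lt_iff in H as [z ->].
    destruct (zero_or_succ z) as [->|[w ->]].
    + right; left; ring.
    + right; right; apply lt_iff; exists w; ring.
Qed.

(* Here and below, [x < y + 1] plays the role of the missing x <= y. *)
Lemma le_iff x y : x < y + 1 <-> exists z, y = x + z.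
Proof.
  rewrite lt_iff; split; intros [z E]; exists z.
  - apply succ_inj; rewrite E; ring.
  - rewrite E; ring.
Qed.

Lemma le_refl x : x < x + 1.
Proof. apply ltS; now right. Qed.

Lemma le_total x y : x < y \/ y < x + 1.
Proof. rewrite ltS; destruct (lt_total x y) as [H|[H|H]]; auto. Qed.

Lemma lt_le_trans x y z : x < y -> y < z + 1 -> x < z.
Proof. rewrite ltS; intros H [H'| <-]; trivial; eapply lt_trans; eauto. Qed.

Lemma le_lt_trans x y z : x < y + 1 -> y < z -> x < z.
Proof. rewrite ltS; intros [H| ->] H'; trivial; eapply lt_trans; eauto. Qed.

Lemma lt_le x y : x < y -> x < y + 1.
Proof. intros H; apply ltS; now left. Qed.

Lemma succ_le x y : x < y -> x + 1 < y + 1.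
Proof. rewrite !lt_iff; intros [z ->]; exists z; ring. Qed.

Lemma least (P : num A -> Prop) a :
  definable P -> P a -> exists x, P x /\ forall y, y < x -> ~ P y.
Proof.
  intros D Ha; apply NNPP; intros H.
  assert (E : forall x y, y < x -> ~ P y).
  { apply (sigma0_induction (fun x => forall y, y < x -> ~ P y)); [def_auto| |].
    - intros y Hy; now apply lt0 in Hy.
    - intros x Hx y; rewrite ltS; intros [Hy| ->]; auto.
      intros Px; apply H; eauto. }
  apply (E (a + 1) a); trivial; apply le_refl.
Qed.

(** * Codes of finite sets *)

Definition pair (a b : num A) : num A := (a + b) * (a + b) + a.

Lemma pair_le a b a' b' :
  a < a' + 1 -> b < b' + 1 -> pair a b < pair a' b' + 1.
Proof.
  rewrite !le_iff; intros [x ->] [y ->].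
  exists ((x + y) * (x + y) + (a + b) * (x + y) + (a + b) * (x + y) + x).
  unfold pair; ring.
Qed.

Lemma pair_fst_le a b : a < pair a b + 1.
Proof. apply le_iff; exists ((a + b) * (a + b)); unfold pair; ring. Qed.

Lemma le_square x : x < x * x + 1.
Proof.
  apply le_iff; destruct (zero_or_succ x) as [->|[y ->]].
  - exists 0; ring.
  - exists (y * (y + 1)); ring.
Qed.

Lemma pair_snd_le a b : b < pair a b + 1.
Proof.
  destruct (proj1 (le_iff _ _) (le_square (a + b))) as [z Hz].
  apply le_iff; exists (a + a + z); unfold pair; rewrite Hz; ring.
Qed.

(** Pairs with sum s have values between s^2 and s^2 + s, hence below (s+1)^2. *)
Lemma pair_sum_lt a b a' b' : a + b < a' + b' -> pair a b < pair a' b'.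
Proof.
  rewrite !lt_iff; intros [z Hz]; unfold pair; rewrite Hz.
  exists ((a + b) + b + (a + b) * z + (a + b) * z + z * (z + 1) + z + a').
  ring.
Qed.

Lemma pair_inj a b a' b' : pair a b = pair a' b' -> a = a' /\ b = b'.
Proof.
  intros H; destruct (lt_total (a + b) (a' + b')) as [L|[E|L]].
  - apply pair_sum_lt in L; rewrite H in L; now apply lt_irrefl in L.
  - unfold pair in H; rewrite E in H.
    rewrite !(addC ((a' + b') * (a' + b'))) in H; apply add_cancel in H; subst.
    split; trivial; apply (add_cancel _ _ a'); now rewrite !(addC _ a').
  - apply pair_sum_lt in L; rewrite H in L; now apply lt_irrefl in L.
Qed.

Definition dvd (a b : num A) : Prop := exists q, a * q = b.

Definition triple (k m n : num A) : num A := pair k (pair m n).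

Definition is_code (c : num A) : Prop := exists k m n, c = triple k m n.

Definition celt (x c : num A) : Prop :=
  exists k m n, c = triple k m n /\ x < k /\ dvd (m * (x + 1) + 1) n.

Lemma dvd_bound a b : dvd (a + 1) b <-> exists q, q < b + 1 /\ (a + 1) * q = b.
Proof.
  split; [|intros [q [_ H]]; now exists q].
  intros [q H]; exists q; split; trivial; apply le_iff.
  exists (a * q); rewrite <- H; ring.
Qed.

Lemma triple_le k m n :
  k < triple k m n + 1 /\ m < triple k m n + 1 /\ n < triple k m n + 1.
Proof.
  unfold triple; split; [apply pair_fst_le|].
  assert (H := pair_snd_le k (pair m n)); apply le_iff in H as [z Hz]; rewrite Hz.
  split.
  - destruct (proj1 (le_iff _ _) (pair_fst_le m n)) as [w Hw].
    apply le_iff; exists (w + z); rewrite Hw at 1; ring.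
  - destruct (proj1 (le_iff _ _) (pair_snd_le m n)) as [w Hw].
    apply le_iff; exists (w + z); rewrite Hw at 1; ring.
Qed.

Lemma triple_inj k m n k' m' n' :
  triple k m n = triple k' m' n' -> k = k' /\ m = m' /\ n = n'.
Proof.
  intros H; apply pair_inj in H as [-> H]; apply pair_inj in H as [-> ->]; auto.
Qed.

(** The components of a triple are at most its code, so the quantifiers can be bounded. The pairing
    is written out because [dstep] recognizes only sums and products. *)
Lemma is_code_bound c :
  is_code c <->
  exists k, k < c + 1 /\ exists m, m < c + 1 /\ exists n, n < c + 1 /\
    c = (k + ((m + n) * (m + n) + m)) * (k + ((m + n) * (m + n) + m)) + k.
Proof.
  split.
  - intros [k [m [n ->]]]; destruct (triple_le k m n) as [H1 [H2 H3]].
    exists k; split; trivial; exists m; split; trivial; exists n; split; trivial.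
  - intros [k [_ [m [_ [n [_ H]]]]]]; exists k, m, n; exact H.
Qed.

Lemma elt_bound x c :
  celt x c <->
  exists k, k < c + 1 /\ exists m, m < c + 1 /\ exists n, n < c + 1 /\
    (c = (k + ((m + n) * (m + n) + m)) * (k + ((m + n) * (m + n) + m)) + k
    /\ (x < k /\ exists q, q < n + 1 /\ (m * (x + 1) + 1) * q = n)).
Proof.
  split.
  - intros [k [m [n [-> [H D]]]]]; destruct (triple_le k m n) as [H1 [H2 H3]].
    exists k; split; trivial; exists m; split; trivial; exists n; split; trivial.
    apply dvd_bound in D; now split.
  - intros [k [_ [m [_ [n [_ [H [L D]]]]]]]]; exists k, m, n.
    split; [exact H|]; split; trivial; now apply dvd_bound.
Qed.

Lemma def_is_code k t : tdef k t -> def k (fun r => is_code (t r)).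
Proof.
  intros H; eapply def_iff; [intros r; symmetry; apply is_code_bound|].
  def_auto.
Qed.

Lemma def_elt k s t : tdef k s -> tdef k t -> def k (fun r => celt (s r) (t r)).
Proof.
  intros Hs Ht; eapply def_iff; [intros r; symmetry; apply elt_bound|].
  def_auto.
Qed.

Lemma tdef_pair k s t : tdef k s -> tdef k t -> tdef k (fun r => pair (s r) (t r)).
Proof. intros; unfold pair; def_auto. Qed.

Lemma def_dvd k s t : tdef k s -> tdef k t -> def k (fun r => dvd (s r + 1) (t r)).
Proof.
  intros; eapply def_iff; [intros r; symmetry; apply dvd_bound|]; def_auto.
Qed.

Ltac cstep :=
  cbv beta;
  lazymatch goal with
  | |- tdef _ (fun r => pair (@?s r) (@?t r)) => apply (tdef_pair _ s t)
  | |- def _ (fun r => dvd (@?s r + 1) (@?t r)) => apply (def_dvd _ s t)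
  | |- def _ (fun r => is_code (@?t r)) => apply (def_is_code _ t)
  | |- def _ (fun r => celt (@?s r) (@?t r)) => apply (def_elt _ s t)
  end.
Ltac code_auto := repeat first [cstep | dstep].

Lemma elt_lt x c : celt x c -> x < c.
Proof.
  intros [k [m [n [-> [H _]]]]]; eapply lt_le_trans; [exact H|apply triple_le].
Qed.

(** * Divisibility and the existence of codes *)

Lemma add_eq0 x y : 0 = x + y -> y = 0.
Proof.
  destruct (zero_or_succ y) as [->|[z ->]]; trivial.
  rewrite addS; intros H; symmetry in H; now apply succ_neq0 in H.
Qed.

Lemma dvd_sub a u v : dvd a (u + v) -> dvd a u -> dvd a v.
Proof.
  intros [q Hq] [p Hp]; subst u; destruct (le_total q p) as [L|L].
  - apply lt_iff in L as [z ->]; exists 0.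
    rewrite mul0; symmetry; apply (add_eq0 (a * (z + 1))), (add_cancel _ _ (a * q)).
    rewrite add0l, Hq at 1; ring.
  - apply le_iff in L as [z ->]; exists z; apply (add_cancel _ _ (a * p)).
    rewrite (addC v), <- Hq; ring.
Qed.

Lemma dvd_mul a b c : dvd a b -> dvd a (b * c).
Proof. intros [q <-]; exists (q * c); ring. Qed.

(** A substitute for the factorial of [K]. The successor form excludes the multiple 0, for which all
    moduli would be 1. *)
Lemma common_multiple K : exists m, forall j, j < K -> dvd (j + 1) (m + 1).
Proof.
  revert K; apply sigma1_induction; [code_auto| |].
  - exists 0; intros j Hj; now apply lt0 in Hj.
  - intros K [m Hm]; exists (m * (K + 1) + K).
    replace (m * (K + 1) + K + 1) with ((m + 1) * (K + 1)) by ring.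
    intros j; rewrite ltS; intros [Hj| ->].
    + now apply dvd_mul, Hm.
    + exists (m + 1); ring.
Qed.

(* Simpson's moduli m(x+1)+1 are pairwise coprime: with d = |x - l| the
   combination (l+1)(m(x+1)+1) - (x+1)(m(l+1)+1) is d up to sign, and d
   divides m. *)
Lemma dvd_coprime m K n x l :
  (forall j, j < K -> dvd (j + 1) m) -> x < K -> l < K -> x <> l ->
  dvd (m * (x + 1) + 1) (n * (m * (l + 1) + 1)) -> dvd (m * (x + 1) + 1) n.
Proof.
  intros Hm Hx Hl Hxl H.
  assert (E : exists d, d < K /\ dvd (m * (x + 1) + 1) (n * (d + 1))).
  { destruct (lt_total x l) as [L|[L|L]]; [|contradiction|];
      apply lt_iff in L as [d ->]; exists d; split.
    - eapply lt_trans; [|exact Hl]; apply lt_iff; exists x; ring.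
    - eapply dvd_sub; [|apply dvd_mul with (c := x + 1), H].
      exists ((x + (d + 1) + 1) * n); ring.
    - eapply lt_trans; [|exact Hx]; apply lt_iff; exists l; ring.
    - apply dvd_sub with ((l + 1) * n * (m * (l + (d + 1) + 1) + 1)).
      + apply dvd_mul with (c := l + (d + 1) + 1) in H; destruct H as [q Hq].
        exists q; rewrite Hq; ring.
      + exists ((l + 1) * n); ring. }
  destruct E as [d [Hd E]]; destruct (Hm d Hd) as [q Hq].
  (* The modulus divides [n * (m * (x + 1) + 1)] trivially, and [n * m * (x + 1)] because [d + 1]
     divides [m]; the difference is [n]. *)
  apply dvd_sub with (n * m * (x + 1)).
  - exists n; ring.
  - apply dvd_mul with (c := q * (x + 1)) in E.
    replace (n * m * (x + 1)) with (n * (d + 1) * (q * (x + 1))); trivial.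
    rewrite <- Hq; ring.
Qed.

Lemma zero_neq_one : 0 <> 1.
Proof.
  intros H; apply (succ_neq0 0); rewrite add0l; now symmetry.
Qed.

Lemma not_dvd_one a : ~ dvd (a + 1 + 1) 1.
Proof.
  intros [q H]; destruct (zero_or_succ q) as [->|[y ->]].
  - rewrite mul0 in H; now apply zero_neq_one.
  - apply (succ_neq0 ((a + 1 + 1) * y + a)), succ_inj.
    transitivity ((a + 1 + 1) * (y + 1)); [ring|now rewrite H, add0l].
Qed.

(** Sigma_1 induction on [l] builds the product of the moduli of all members of [P] below [l].
    Multiplying by the modulus of [l] adds [l] to the coded set and, by coprimality, no other number
    below [K]. *)
Lemma code_exists P K :
  definable P -> exists c, is_code c /\ forall x, celt x c <-> x < K /\ P x.
Proof.
  intros D; destruct (common_multiple K) as [m Hm].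
  assert (E : forall l, exists n, forall x, x < K ->
             (dvd ((m + 1) * (x + 1) + 1) n <-> x < l /\ P x)).
  { apply sigma1_induction; [code_auto| |].
    - exists 1; intros x Hx; split.
      + intros H; exfalso; apply (not_dvd_one (m * (x + 1) + x)).
        replace (m * (x + 1) + x + 1 + 1) with ((m + 1) * (x + 1) + 1) by ring.
        exact H.
      + intros [H _]; now apply lt0 in H.
    (* Beyond [K] there is nothing to add, and coprimality is available only below [K]. *)
    - intros l [n Hn]; destruct (le_total K l) as [L|L].
      { exists n; intros x Hx; rewrite Hn; trivial.
        assert (x < l) by (eapply lt_trans; eauto).
        split; intros [_ Px]; split; trivial; now apply lt_le. }
      apply ltS in L; destruct (classic (l < K /\ P l)) as [[Hl Pl]|Pl].
      + exists (n * ((m + 1) * (l + 1) + 1)); intros x Hx; rewrite ltS.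
        destruct (classic (x = l)) as [->|Hxl].
        * split; auto; intros _; exists n; ring.
        * transitivity (x < l /\ P x).
          -- rewrite <- Hn; trivial; split; [|apply dvd_mul].
             now apply dvd_coprime with K.
          -- tauto.
      + exists n; intros x Hx; rewrite Hn, ltS; trivial.
        destruct (classic (x = l)) as [->|Hxl]; [|tauto].
        assert (~ l < l) by apply lt_irrefl; tauto. }
  destruct (E K) as [n Hn]; exists (triple K (m + 1) n); split.
  { now exists K, (m + 1), n. }
  intros x; split.
  - intros [K' [m' [n' [H [Hx Hd]]]]]; apply triple_inj in H as [<- [<- <-]].
    now apply Hn.
  - intros [Hx Px]; exists K, (m + 1), n; split; trivial; split; trivial.
    apply Hn; auto.
Qed.

(** * Finite sequences *)

Definition haslen (s l : num A) : Prop :=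
  forall i, i < l <-> exists v, celt (pair i v) s.

Definition functional (s : num A) : Prop :=
  forall i v w, celt (pair i v) s /\ celt (pair i w) s -> v = w.

Definition isseq (s : num A) : Prop :=
  is_code s /\ (forall z, celt z s -> exists i v, z = pair i v) /\
  functional s /\ (exists l, haslen s l) /\
  forall d, d < s /\ is_code d -> ~ forall x, celt x d <-> celt x s.

Lemma elt_pair_lt i v s : celt (pair i v) s -> i < s /\ v < s.
Proof.
  intros H; apply elt_lt in H; split; eapply le_lt_trans; eauto.
  - apply pair_fst_le.
  - apply pair_snd_le.
Qed.

Lemma haslen_le s l : haslen s l -> l < s + 1.
Proof.
  intros H; destruct (le_total s l) as [L|L]; trivial.
  apply H in L as [v Hv]; apply elt_pair_lt in Hv as [Hv _].
  now apply lt_irrefl in Hv.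
Qed.

(** Members of a code and their two components lie below the code, and the length is at most the
    code, so every quantifier can be bounded. *)
Lemma isseq_bound s :
  isseq s <->
  is_code s /\
  (forall z, z < s -> celt z s ->
     exists i, i < z + 1 /\ exists v, v < z + 1 /\ z = pair i v) /\
  (forall i, i < s -> forall v, v < s -> forall w, w < s ->
     celt (pair i v) s /\ celt (pair i w) s -> v = w) /\
  (exists l, l < s + 1 /\ forall i, i < s + 1 ->
     (i < l <-> exists v, v < s /\ celt (pair i v) s)) /\
  (forall d, d < s -> is_code d -> ~ forall x, x < s -> (celt x d <-> celt x s)).
Proof.
  unfold isseq, functional; split; intros [H1 [H2 [H3 [H4 H5]]]];
    split; trivial; repeat split.
  - intros z _ Hz; destruct (H2 z Hz) as [i [v ->]].
    exists i; split; [apply pair_fst_le|].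
    exists v; split; [apply pair_snd_le|reflexivity].
  - intros i _ v _ w _; apply H3.
  - destruct H4 as [l Hl]; exists l; split; [now apply haslen_le|].
    intros i _; rewrite (Hl i); split; intros [v Hv]; exists v.
    + split; trivial; now apply elt_pair_lt in Hv.
    + apply Hv.
  - intros d Hd Cd H; apply (H5 d); auto; intros x; split; intros Hx.
    + apply H; trivial; eapply lt_trans; [apply elt_lt, Hx|trivial].
    + apply H; trivial; now apply elt_lt.
  - intros z Hz; destruct (H2 z (elt_lt _ _ Hz) Hz) as [i [_ [v [_ E]]]]; eauto.
  - intros i v w [Hv Hw].
    destruct (elt_pair_lt _ _ _ Hv), (elt_pair_lt _ _ _ Hw); now apply (H3 i).
  - destruct H4 as [l [Ll Hl]]; exists l; intros i; split.
    + intros Hi; apply Hl in Hi.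
      * destruct Hi as [v [_ Hv]]; eauto.
      * eapply lt_trans; eauto.
    + intros [v Hv]; apply Hl.
      * apply lt_le; apply (elt_pair_lt _ _ _ Hv).
      * exists v; split; trivial; apply (elt_pair_lt _ _ _ Hv).
  - intros d [Hd Cd] H; apply (H5 d); auto.
Qed.

Lemma def_isseq k t : tdef k t -> def k (fun r => isseq (t r)).
Proof.
  intros H; eapply def_iff; [intros r; symmetry; apply isseq_bound|].
  code_auto.
Qed.

Definition isbinary (s : num A) : Prop :=
  forall i v, celt (pair i v) s -> v < 1 + 1.

Lemma def_isbinary k t : tdef k t -> def k (fun r => isbinary (t r)).
Proof.
  intros H; apply def_iff with (fun r => forall i, i < t r -> forall v, v < t r ->
                                 celt (pair i v) (t r) -> v < 1 + 1).
  - intros r; split; intros E i v; eauto.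
    intros Hv; apply E with i; trivial; apply (elt_pair_lt _ _ _ Hv).
  - code_auto.
Qed.

(** Bridges [code_exists], which yields some code of a set, and [isseq], which accepts only the
    least one. *)
Lemma least_code c :
  is_code c -> exists s, is_code s /\ (forall x, celt x s <-> celt x c) /\
    forall d, d < s /\ is_code d -> ~ forall x, celt x d <-> celt x s.
Proof.
  intros Hc.
  (* Members of either code lie below [s + c], so this bounded comparison already amounts to
     equality of the coded sets. *)
  destruct (least (fun s => is_code s /\
              forall x, x < s + c -> (celt x s <-> celt x c)) c) as [s [[Cs Es] Ms]].
  - intros k t Ht; code_auto.
  - split; trivial; tauto.
  - assert (E : forall x, celt x s <-> celt x c).
    { assert (Ls : s < s + c + 1) by (apply le_iff; eauto).
      assert (Lc : c < s + c + 1) by (apply le_iff; exists s; ring).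
      intros x; split; intros Hx; apply Es; trivial;
        (eapply lt_le_trans; [apply elt_lt, Hx|trivial]). }
    exists s; split; trivial; split; trivial.
    intros d [Ld Cd] Ed; apply (Ms d Ld); split; trivial.
    intros x _; rewrite Ed; apply E.
Qed.

Lemma one_lt_two : 1 < 1 + 1.
Proof. apply le_refl. Qed.

Lemma zero_lt_two : 0 < 1 + 1.
Proof. apply lt_iff; exists 1; ring. Qed.

Lemma lt_two v : v < 1 + 1 -> v = 0 \/ v = 1.
Proof.
  rewrite ltS; intros [H|H]; auto.
  assert (E : v < 0 + 1) by now rewrite add0l.
  apply ltS in E as [E|E]; auto; now apply lt0 in E.
Qed.

Lemma seq_exists P n :
  definable P ->
  exists s, isseq s /\ isbinary s /\ haslen s n /\
    forall x v, celt (pair x v) s <-> x < n /\ (P x /\ v = 1 \/ ~ P x /\ v = 0).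
Proof.
  intros D.
  (* The bound [pair n 1 + 1] loses nothing: by monotonicity all the pairs in question are at most
     [pair n 1]. *)
  destruct (code_exists (fun z => exists x, x < n /\
              (P x /\ z = pair x 1 \/ ~ P x /\ z = pair x 0)) (pair n 1 + 1))
    as [c [Cc Hc]].
  { intros k t Ht; code_auto. }
  destruct (least_code c Cc) as [s [Cs [Es Ms]]].
  assert (E : forall z, celt z s <-> exists x, x < n /\
              (P x /\ z = pair x 1 \/ ~ P x /\ z = pair x 0)).
  { intros z; rewrite Es, Hc; split; [now intros [_ H]|].
    intros [x [Hx H]]; split; [|now exists x].
    destruct H as [[_ ->]|[_ ->]]; apply pair_le; try now apply lt_le.
    - apply le_refl.
    - apply zero_lt_two. }
  assert (E' : forall x v, celt (pair x v) s <->
                 x < n /\ (P x /\ v = 1 \/ ~ P x /\ v = 0)).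
  { intros x v; rewrite E; split.
    - intros [y [Hy [[Py H]|[Py H]]]]; apply pair_inj in H as [-> ->]; auto.
    - intros [Hx [[Px ->]|[Px ->]]]; exists x; auto. }
  assert (L : haslen s n).
  { intros i; split.
    - intros Hi; destruct (classic (P i)) as [Pi|Pi].
      + exists 1; apply E'; auto.
      + exists 0; apply E'; auto.
    - intros [v Hv]; now apply E' in Hv. }
  exists s; split; [|split; [|split]]; trivial.
  - split; trivial; split; [|split; [|split]]; trivial; [| |now exists n].
    + intros z Hz; apply E in Hz as [x [_ [[_ ->]|[_ ->]]]]; eauto.
    + intros i v w [Hv Hw]; apply E' in Hv as [_ Hv]; apply E' in Hw as [_ Hw].
      destruct Hv as [[? ->]|[? ->]], Hw as [[? ->]|[? ->]]; tauto.
  - intros i v Hv; apply E' in Hv as [_ [[_ ->]|[_ ->]]].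
    + apply one_lt_two.
    + apply zero_lt_two.
Qed.

(** * Enumerating an infinite set *)

Section Enumeration.

Context (D : sets A) (a : num A) (Da : mem A a D).
Context (D_inf : forall n, exists x, n < x /\ mem A x D).

Definition next (d e : num A) : Prop :=
  mem A e D /\ d < e /\ forall y, y < e -> d < y -> ~ mem A y D.

Lemma next_exists d : exists e, next d e.
Proof.
  destruct (D_inf d) as [b Hb].
  destruct (least (fun x => d < x /\ mem A x D) b) as [e [[He1 He2] Me]]; trivial.
  - intros k t Ht; def_auto.
  - exists e; split; trivial; split; trivial.
    intros y Hy Hdy Dy; now apply (Me y).
Qed.

Lemma next_unique d e e' : next d e -> next d e' -> e = e'.
Proof.
  intros [D1 [L1 M1]] [D2 [L2 M2]].
  destruct (lt_total e e') as [H|[H|H]]; trivial; exfalso.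
  - now apply (M2 e).
  - now apply (M1 e').
Qed.

(* s codes a list of pairs (i, d_i), i <= n, where d_0 = a and d_(i+1) is the
   successor of d_i in D; pairs with larger first component are unconstrained. *)
Definition enumerates (s n : num A) : Prop :=
  celt (pair 0 a) s /\
  (forall i, i < n -> forall d, d < s -> celt (pair i d) s ->
     exists e, e < s /\ (next d e /\ celt (pair (i + 1) e) s)) /\
  (forall i, i < s -> forall d, d < s -> forall e, e < s ->
     celt (pair i d) s /\ celt (pair i e) s -> d = e).

Lemma def_enumerates k s t :
  tdef k s -> tdef k t -> def k (fun r => enumerates (s r) (t r)).
Proof. intros; unfold enumerates, next; code_auto. Qed.

Lemma enumerates_functional s n : enumerates s n -> functional s.
Proof.
  intros [_ [_ H]] i d e [Hd He].
  destruct (elt_pair_lt _ _ _ Hd), (elt_pair_lt _ _ _ He).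
  now apply (H i).
Qed.

Lemma enumerates_next s n i d :
  enumerates s n -> i < n -> celt (pair i d) s ->
  exists e, next d e /\ celt (pair (i + 1) e) s.
Proof.
  intros [_ [H _]] Hi Hd.
  destruct (H i Hi d) as [e [_ He]]; trivial; [|now exists e].
  apply (elt_pair_lt _ _ _ Hd).
Qed.

Lemma succ_lt x y : x + 1 < y + 1 -> x < y.
Proof.
  rewrite !lt_iff; intros [z E]; exists z; apply succ_inj; rewrite E; ring.
Qed.

(** Strict growth over earlier values gives [enumerates_inj], and i <= d_i limits the search for an
    index in [diagonal]. The bound [d < s] keeps the induction formula bounded. *)
Lemma enumerates_value s n i :
  enumerates s n -> i < n + 1 ->
  exists d, d < s /\ (celt (pair i d) s /\ (mem A d D /\ (i < d + 1 /\
    forall j, j < i -> forall c, c < s -> celt (pair j c) s -> c < d))).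
Proof.
  intros Hs; revert i; apply (sigma0_induction (fun i => i < n + 1 -> exists d,
    d < s /\ (celt (pair i d) s /\ (mem A d D /\ (i < d + 1 /\
    forall j, j < i -> forall c, c < s -> celt (pair j c) s -> c < d))))).
  { code_auto. }
  - intros _; exists a; assert (H := proj1 Hs).
    split; [apply (elt_pair_lt _ _ _ H)|]; split; trivial; split; trivial; split.
    + apply le_iff; exists a; ring.
    + intros j Hj; now apply lt0 in Hj.
  - intros i IH Hi; apply succ_lt in Hi.
    destruct IH as [d [Ld [Hd [_ [Lid Md]]]]]; [now apply lt_le|].
    destruct (enumerates_next s n i d Hs Hi Hd) as [e [[De [Lde _]] He]].
    exists e; split; [apply (elt_pair_lt _ _ _ He)|]; split; trivial; split; trivial.
    split; [apply succ_le; eapply le_lt_trans; eauto|].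
    intros j Hj c Lc Hc; apply ltS in Hj as [Hj| ->].
    + eapply lt_trans; [|exact Lde]; now apply (Md j).
    + now rewrite (enumerates_functional s n Hs i c d).
Qed.

(** The value at an index does not depend on the code, which lets [diagonal] pass from some code to
    every code. *)
Lemma enumerates_agree s n s' n' i :
  enumerates s n -> enumerates s' n' -> i < n + 1 -> i < n' + 1 ->
  exists d, d < s /\ (celt (pair i d) s /\ celt (pair i d) s').
Proof.
  intros Hs Hs'; revert i;
    apply (sigma0_induction (fun i => i < n + 1 -> i < n' + 1 ->
      exists d, d < s /\ (celt (pair i d) s /\ celt (pair i d) s'))).
  { code_auto. }
  - intros _ _; exists a; assert (H := proj1 Hs).
    split; [apply (elt_pair_lt _ _ _ H)|]; split; trivial; apply Hs'.
  - intros i IH Hi Hi'; apply succ_lt in Hi, Hi'.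
    destruct IH as [d [_ [Hd Hd']]]; try now apply lt_le.
    destruct (enumerates_next s n i d Hs Hi Hd) as [e [Ne He]].
    destruct (enumerates_next s' n' i d Hs' Hi' Hd') as [e' [Ne' He']].
    rewrite <- (next_unique d e e') in He' by trivial.
    exists e; split; auto; apply (elt_pair_lt _ _ _ He).
Qed.

Lemma enumerates_inj s n i j d :
  enumerates s n -> i < n + 1 -> j < n + 1 ->
  celt (pair i d) s -> celt (pair j d) s -> i = j.
Proof.
  intros Hs.
  assert (E : forall i j, i < j -> j < n + 1 ->
            celt (pair i d) s -> celt (pair j d) s -> False).
  { clear i j; intros i j Hij Hj Hi' Hj'.
    destruct (enumerates_value s n j Hs Hj) as [e [_ [He [_ [_ M]]]]].
    rewrite (enumerates_functional s n Hs j e d) in M by auto.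
    apply (lt_irrefl d), (M i); trivial; apply (elt_pair_lt _ _ _ Hi'). }
  intros Li Lj Hi Hj; destruct (lt_total i j) as [H|[H|H]]; trivial; exfalso.
  - now apply (E i j).
  - now apply (E j i).
Qed.

Lemma enumerates_exists n : exists s, enumerates s n.
Proof.
  revert n; apply (sigma1_induction (fun n s => enumerates s n)).
  { apply def_enumerates; def_auto. }
  - destruct (code_exists (fun z => z = pair 0 a) (pair 0 a + 1)) as [s [_ Hs]].
    { intros k t Ht; code_auto. }
    exists s; split; [|split].
    + apply Hs; split; trivial; apply le_refl.
    + intros i Hi; now apply lt0 in Hi.
    + intros i _ d _ e _ [Hd He].
      apply Hs in Hd as [_ Hd]; apply Hs in He as [_ He].
      apply pair_inj in Hd as [_ ->]; apply pair_inj in He as [_ ->]; trivial.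
  - intros n [s Hs].
    destruct (enumerates_value s n n Hs (le_refl n)) as [d [_ [Hd _]]].
    destruct (next_exists d) as [e Ne].
    (* Only pairs with index at most [n] are kept: [s] may already hold a pair with index [n + 1],
       and a second value there would break functionality. *)
    destruct (code_exists (fun z =>
       (exists i, i < n + 1 /\ exists c, c < s /\ (z = pair i c /\ celt z s))
       \/ z = pair (n + 1) e) (s + pair (n + 1) e + 1)) as [s' [_ Hs']].
    { intros k t Ht; code_auto. }
    assert (E1 : forall i c, i < n + 1 -> celt (pair i c) s -> celt (pair i c) s').
    { intros i c Hi Hc; apply Hs'; split.
      - eapply lt_le_trans; [apply elt_lt, Hc|].
        apply le_iff; exists (pair (n + 1) e + 1); ring.
      - left; exists i; split; trivial; exists c.
        destruct (elt_pair_lt _ _ _ Hc); auto. }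
    assert (E2 : celt (pair (n + 1) e) s').
    { apply Hs'; split; [|now right].
      apply le_iff; exists s; ring. }
    assert (E3 : forall i c, celt (pair i c) s' ->
              i < n + 1 /\ celt (pair i c) s \/ i = n + 1 /\ c = e).
    { intros i c Hc; apply Hs' in Hc as [_ [[j [Hj [c' [_ [H Hc]]]]]|H]].
      - apply pair_inj in H as [-> ->]; auto.
      - apply pair_inj in H as [-> ->]; auto. }
    exists s'; split; [|split].
    + apply E1; [|apply Hs]; apply le_iff; exists n; ring.
    + intros i Hi c _ Hc; destruct (E3 i c Hc) as [[Li Hc']|[-> _]];
        [|now apply lt_irrefl in Hi].
      apply ltS in Hi as [Hi| ->].
      * destruct (enumerates_next s n i c Hs Hi Hc') as [b [Nb Hb]].
        apply E1 in Hb; [|now apply succ_le].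
        exists b; split; [apply (elt_pair_lt _ _ _ Hb)|auto].
      * rewrite (enumerates_functional s n Hs n c d) by auto.
        exists e; split; [apply (elt_pair_lt _ _ _ E2)|auto].
    + intros i _ c _ b _ [Hc Hb].
      destruct (E3 i c Hc) as [[Li Hc']|[-> ->]], (E3 _ b Hb) as [[Li' Hb']|[E ->]];
        trivial.
      * now apply (enumerates_functional s n Hs i).
      * subst; now apply lt_irrefl in Li.
      * now apply lt_irrefl in Li'.
Qed.

Lemma diagonal Z :
  exists X, (forall x, mem A x X -> mem A x D) /\
    forall n, exists d, mem A d D /\ (mem A d X <-> ~ mem A (pair n d) Z).
Proof.
  (* [Q] gives the Sigma_1 and [Q'] the Pi_1 form of membership in [X]. Enumerating up to index [x]
     is enough, because the index of a value never exceeds the value. *)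
  pose (Q x s := enumerates s x /\
    exists i, i < x + 1 /\ (celt (pair i x) s /\ ~ mem A (pair i x) Z)).
  pose (Q' x s := enumerates s x ->
    exists i, i < x + 1 /\ (celt (pair i x) s /\ ~ mem A (pair i x) Z)).
  destruct (comprehension (fun x => exists s, Q x s) Q Q') as [X HX].
  - apply (def_and 2); [apply def_enumerates; def_auto|code_auto].
  - apply (def_imp 2); [apply def_enumerates; def_auto|code_auto].
  - tauto.
  - intros x; split.
    + intros [s [Hs [i [Li [Hi HZ]]]]] s' Hs'; exists i; split; trivial; split; trivial.
      destruct (enumerates_agree s x s' x i) as [d [_ [Hd Hd']]]; trivial.
      now rewrite (enumerates_functional s x Hs i x d).
    + intros H; destruct (enumerates_exists x) as [s Hs]; exists s; split; auto.
      now apply H.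
  - exists X; split.
    + intros x Hx; apply HX in Hx as [s [Hs [i [Li [Hi _]]]]].
      destruct (enumerates_value s x i Hs Li) as [d [_ [Hd [Dd _]]]].
      now rewrite (enumerates_functional s x Hs i x d).
    + intros n; destruct (enumerates_exists n) as [s Hs].
      destruct (enumerates_value s n n Hs (le_refl n)) as [d [_ [Hd [Dd [Lnd _]]]]].
      exists d; split; trivial.
      assert (E : forall s', enumerates s' d -> celt (pair n d) s').
      { intros s' Hs'.
        destruct (enumerates_agree s n s' d n) as [e [_ [He He']]];
          auto using le_refl.
        now rewrite (enumerates_functional s n Hs n d e). }
      rewrite HX; split.
      * intros [s' [Hs' [i [Li [Hi HZ]]]]].
        now rewrite (enumerates_inj s' d n i d) by auto.
      * intros HZ; destruct (enumerates_exists d) as [s' Hs'].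
        exists s'; split; trivial; exists n; auto.
Qed.

End Enumeration.

(** * Weak Koenig's lemma and separating initial intervals *)

(** Descends through formula and meaning in parallel; hence the semantic definitions copy the
    formulas connective by connective, keeping conjunctive premises uncurried. Abbreviations such as
    [elt] stay folded and are closed by their own lemmas. *)
Ltac sat_step :=
  lazymatch goal with
  | |- sat _ _ _ (AllN _) <-> _ =>
      etransitivity; [apply sat_AllN|apply forall_iff; intros ?]
  | |- sat _ _ _ (AllS _) <-> _ =>
      etransitivity; [apply sat_AllS|apply forall_iff; intros ?]
  | |- sat _ _ _ (ExN _) <-> _ =>
      etransitivity; [apply sat_ExN|apply exists_iff; intros ?]
  | |- sat _ _ _ (ExS _) <-> _ =>
      etransitivity; [apply sat_ExS|apply exists_iff; intros ?]
  | |- sat _ _ _ (And _ _) <-> _ =>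
      etransitivity; [apply sat_And|apply and_iff]
  | |- sat _ _ _ (Iff _ _) <-> _ =>
      etransitivity; [apply sat_Iff|apply iff_iff]
  | |- sat _ _ _ (Neg _) <-> _ =>
      etransitivity; [apply sat_Neg|apply not_iff_compat]
  | |- sat _ _ _ (Imp _ _) <-> _ =>
      etransitivity; [apply sat_Imp|apply imp_iff]
  | |- sat _ _ _ ?p <-> _ =>
      lazymatch p with Eq _ _ => idtac | Lt _ _ => idtac | Mem _ _ => idtac end;
      simpl; unfold lift; rewrite ?eval_tsubst; reflexivity
  end.

Lemma sat_divides r v s t :
  sat A r v (divides s t) <-> dvd (eval A r s) (eval A r t).
Proof. unfold divides; repeat sat_step. Qed.

Lemma sat_elt r v x c : sat A r v (elt x c) <-> celt (eval A r x) (eval A r c).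
Proof.
  unfold elt; repeat sat_step.
  etransitivity; [apply sat_divides|].
  simpl; unfold lift; rewrite eval_tsubst; reflexivity.
Qed.

Lemma sat_is_triple r v c : sat A r v (is_triple c) <-> is_code (eval A r c).
Proof. unfold is_triple; repeat sat_step. Qed.

Lemma sat_has_length r v s l :
  sat A r v (has_length (Var s) (Var l)) <-> haslen (r s) (r l).
Proof. unfold has_length; repeat sat_step; apply sat_elt. Qed.

Lemma sat_Seq r v s : sat A r v (Seq (Var s)) <-> isseq (r s).
Proof.
  unfold Seq; repeat sat_step;
    (apply sat_elt || apply sat_is_triple || apply sat_has_length).
Qed.

Lemma sat_binary r v s : sat A r v (binary (Var s)) <-> isbinary (r s).
Proof. unfold binary; repeat sat_step; apply sat_elt. Qed.

Lemma sat_weak_Koenig r v :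
  sat A r v weak_Koenig <->
  forall T,
    ((forall s, mem A s T -> isseq s /\ isbinary s) /\
     (forall s t, mem A s T /\ isseq t /\ (forall z, celt z t -> celt z s) ->
        mem A t T)) /\
    (forall n, exists s, n < s /\ mem A s T) ->
  exists F,
    ((forall z, mem A z F -> exists x y, z = pair x y) /\
     (forall x, exists y, mem A (pair x y) F) /\
     (forall x y z, mem A (pair x y) F /\ mem A (pair x z) F -> y = z)) /\
    forall n, exists s, mem A s T /\ haslen s n /\ forall z, celt z s -> mem A z F.
Proof.
  unfold weak_Koenig, binary_tree, infinite, path, total_function, initial_segment.
  repeat sat_step;
    (apply sat_elt || apply sat_has_length || apply sat_Seq || apply sat_binary).
Qed.

Lemma sat_partial_order r v P R :
  sat A r v (partial_order P R) <->
  (forall z, mem A z (v R) ->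
     exists x y, z = pair x y /\ mem A x (v P) /\ mem A y (v P)) /\
  (forall x, mem A x (v P) -> mem A (pair x x) (v R)) /\
  (forall x y, mem A (pair x y) (v R) /\ mem A (pair y x) (v R) -> x = y) /\
  (forall x y z, mem A (pair x y) (v R) /\ mem A (pair y z) (v R) ->
     mem A (pair x z) (v R)).
Proof. unfold partial_order; repeat sat_step. Qed.

Lemma sat_countably_many_initial_intervals r v P R :
  sat A r v (countably_many_initial_intervals P R) <->
  exists Z, forall I,
    (forall x, mem A x I -> mem A x (v P)) /\
    (forall x y, mem A (pair x y) (v R) /\ mem A y I -> mem A x I) ->
    exists n, forall x, mem A x I <-> mem A (pair n x) Z.
Proof.
  unfold countably_many_initial_intervals, initial_interval; repeat sat_step.
Qed.

Lemma sat_has_infinite_antichain r v P R :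
  sat A r v (has_infinite_antichain P R) <->
  exists D,
    ((forall x, mem A x D -> mem A x (v P)) /\
     (forall x y, mem A x D /\ mem A y D /\ x <> y ->
        ~ mem A (pair x y) (v R) /\ ~ mem A (pair y x) (v R))) /\
    forall n, exists x, n < x /\ mem A x D.
Proof. unfold has_infinite_antichain, antichain, infinite; repeat sat_step. Qed.

Context (WKL : forall r v, sat A r v weak_Koenig).

Section Separation.

Context (P R D X : sets A).
Context (R_dom : forall z, mem A z R ->
           exists x y, z = pair x y /\ mem A x P /\ mem A y P).
Context (R_refl : forall x, mem A x P -> mem A (pair x x) R).
Context (R_trans : forall x y z,
           mem A (pair x y) R /\ mem A (pair y z) R -> mem A (pair x z) R).
Context (D_sub : forall x, mem A x D -> mem A x P).
Context (D_anti : forall x y, mem A x D /\ mem A y D /\ x <> y ->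
           ~ mem A (pair x y) R /\ ~ mem A (pair y x) R).
Context (X_sub : forall x, mem A x X -> mem A x D).

Lemma R_dom_fst x y : mem A (pair x y) R -> mem A x P.
Proof.
  intros H; destruct (R_dom _ H) as [x' [y' [E [Hx _]]]].
  now apply pair_inj in E as [-> _].
Qed.

(* Initial segments of the characteristic function of an initial interval that
   contains X and avoids the rest of D.  All conditions are negative in s, hence
   inherited by initial segments. *)
Definition approx (s : num A) : Prop :=
  (forall x, x < s -> celt (pair x 1) s -> mem A x P) /\
  (forall x, x < s -> forall y, y < s -> mem A (pair x y) R ->
     ~ (celt (pair y 1) s /\ celt (pair x 0) s)) /\
  (forall x, x < s -> mem A x X -> ~ celt (pair x 0) s) /\
  (forall x, x < s -> mem A x D /\ ~ mem A x X -> ~ celt (pair x 1) s).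

Lemma approx_sub s t :
  approx s -> (forall z, celt z t -> celt z s) -> approx t.
Proof.
  intros [H1 [H2 [H3 H4]]] Hts; split; [|split; [|split]].
  - intros x _ Hx; apply Hts in Hx; apply H1; trivial; apply (elt_pair_lt _ _ _ Hx).
  - intros x _ y _ Hxy [Hy Hx]; apply Hts in Hy, Hx.
    apply (H2 x) with y; auto.
    + apply (elt_pair_lt _ _ _ Hx).
    + apply (elt_pair_lt _ _ _ Hy).
  - intros x _ HX Hx; apply Hts in Hx; apply (H3 x); trivial.
    apply (elt_pair_lt _ _ _ Hx).
  - intros x _ HX Hx; apply Hts in Hx; apply (H4 x); trivial.
    apply (elt_pair_lt _ _ _ Hx).
Qed.

(** The node is the downward closure of the part of [X] below [n], restricted to arguments below
    [n]; with this bound it is definable, unlike the full closure. Reflexivity puts [X] inside,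
    transitivity gives downward closure, and the antichain property keeps the rest of [D] out. *)
Lemma approx_exists n :
  exists s, isseq s /\ isbinary s /\ approx s /\ haslen s n.
Proof.
  destruct (seq_exists (fun x => exists y, y < n /\
              (mem A y X /\ mem A (pair x y) R)) n)
    as [s [Hs [Bs [Ls Es]]]].
  { intros k t Ht; code_auto. }
  exists s; split; trivial; split; trivial; split; trivial.
  assert (E1 : forall x, celt (pair x 1) s ->
            exists y, y < n /\ (mem A y X /\ mem A (pair x y) R)).
  { intros x Hx; apply Es in Hx as [_ [[H _]|[_ H]]]; trivial.
    symmetry in H; now apply zero_neq_one in H. }
  assert (E0 : forall x, celt (pair x 0) s -> x < n /\
            ~ exists y, y < n /\ (mem A y X /\ mem A (pair x y) R)).
  { intros x Hx; apply Es in Hx as [Hx [[_ H]|[H _]]]; auto.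
    now apply zero_neq_one in H. }
  split; [|split; [|split]].
  - intros x _ Hx; apply E1 in Hx as [y [_ [_ Hxy]]]; eapply R_dom_fst; eauto.
  - intros x _ y _ Hxy [Hy Hx]; apply E0 in Hx as [_ Hx]; apply Hx.
    apply E1 in Hy as [z [Lz [Xz Hyz]]]; exists z; split; trivial; split; trivial.
    apply R_trans with y; auto.
  - intros x _ HX Hx; apply E0 in Hx as [Lx Hx]; apply Hx; exists x; auto 6.
  - intros x _ [Dx HX] Hx; apply E1 in Hx as [y [_ [Xy Hxy]]].
    destruct (classic (x = y)) as [->|Hn]; [contradiction|].
    destruct (D_anti x y) as [H _]; auto.
Qed.

(** Each clause of [approx] concerns at most two arguments, so it passes from the nodes along a path
    to the whole path; the interval consists of the arguments with value 1. *)
Lemma separating_interval :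
  exists I, (forall x, mem A x I -> mem A x P) /\
    (forall x y, mem A (pair x y) R /\ mem A y I -> mem A x I) /\
    forall x, mem A x D -> (mem A x I <-> mem A x X).
Proof.
  destruct (comprehension0 (fun s => isseq s /\ isbinary s /\ approx s)) as [T HT].
  { apply (def_and 2); [apply def_isseq; def_auto|].
    apply (def_and 2); [apply def_isbinary; def_auto|unfold approx; code_auto]. }
  destruct (proj1 (sat_weak_Koenig r0 v0) (WKL r0 v0) T) as [F [[_ [_ F_fun]] HF]];
    [split; [split|]|].
  - intros s Hs; apply HT in Hs; tauto.
  - intros s t [Hs [Ht Hts]]; apply HT in Hs as [_ [Bs As]]; apply HT.
    split; trivial; split; [|now apply approx_sub with s].
    intros i v Hv; apply (Bs i); auto.
  (* An infinite tree is one with unbounded codes. A code is at least its length, so length [n + 1]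
     puts it above [n]. *)
  - intros n; destruct (approx_exists (n + 1)) as [s [Hs [Bs [As Ls]]]].
    exists s; split; [|now apply HT].
    apply haslen_le in Ls; now apply succ_lt.
  - (* Any two arguments of F are covered by one node of the tree. *)
    assert (C : forall x y, exists s, approx s /\
              (forall z, z = x \/ z = y -> z < s /\ exists v,
                 (v = 0 \/ v = 1) /\ celt (pair z v) s /\ mem A (pair z v) F)).
    { intros x y; destruct (HF (x + y + 1)) as [s [Hs [Ls Fs]]].
      apply HT in Hs as [_ [Bs As]]; exists s; split; trivial.
      intros z Hz; assert (Lz : z < x + y + 1).
      { apply le_iff; destruct Hz as [->| ->]; [exists y|exists x]; ring. }
      apply Ls in Lz as [v Hv]; split; [apply (elt_pair_lt _ _ _ Hv)|].
      exists v; split; auto; apply lt_two, (Bs z), Hv. }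
    assert (F1 : forall z, mem A (pair z 1) F -> mem A (pair z 0) F -> False).
    { intros z H1 H0; apply zero_neq_one, (F_fun z); auto. }
    destruct (comprehension0 (fun x => mem A (pair x 1) F)) as [I HI]; [code_auto|].
    exists I; split; [|split].
    + intros x Hx; apply HI in Hx; destruct (C x x) as [s [As Hs]].
      destruct (Hs x) as [Lx [v [[->| ->] [Ev Fv]]]]; auto.
      * now destruct (F1 x).
      * now apply As.
    + intros x y [Hxy Hy]; apply HI in Hy; apply HI.
      destruct (C x y) as [s [As Hs]].
      destruct (Hs x) as [Lx [v [[->| ->] [Ev Fv]]]]; auto.
      destruct (Hs y) as [Ly [w [[->| ->] [Ew Fw]]]]; auto.
      * now destruct (F1 y).
      * exfalso; destruct As as [_ [H _]]; now apply (H x Lx y Ly).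
    + intros x Dx; rewrite HI; destruct (C x x) as [s [[_ [_ [A1 A2]]] Hs]].
      destruct (Hs x) as [Lx [v [[->| ->] [Ev Fv]]]]; auto.
      * split; [intros H; now destruct (F1 x)|].
        intros HX; exfalso; now apply (A1 x).
      * split; trivial; intros _; apply NNPP; intros HX; now apply (A2 x).
Qed.

End Separation.

End Model.

Theorem theorem5p10 :
  WKL0 |--
    AllS (AllS (partial_order 1 0
                ⟶ countably_many_initial_intervals 1 0
                ⟶ ~ has_infinite_antichain 1 0)).
Proof.
  apply completeness; intros A r v HA Hr Hv.
  assert (HR : models A RCA0) by (intros p Hp; now apply HA, WKL0_RCA0).
  assert (HW : forall r v, sat A r v weak_Koenig) by apply (HA _ WKL0_WKL).
  intros P R.
  rewrite !sat_Imp, sat_Neg, sat_partial_order, sat_countably_many_initial_intervals,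
    sat_has_infinite_antichain; simpl.
  intros [R_dom [R_refl [_ R_trans]]] [Z HZ] [D [[D_sub D_anti] D_inf]].
  (* The enumeration may start at any element of [D]; it need not be the least one. *)
  destruct (D_inf (zero A)) as [a [_ Da]].
  destruct (diagonal A r v HR Hr Hv D a Da D_inf Z) as [X [X_sub HX]].
  destruct (separating_interval A r v HR Hr Hv HW P R D X)
    as [I [I_sub [I_down HI]]]; trivial.
  destruct (HZ I (conj I_sub I_down)) as [n Hn].
  destruct (HX n) as [d [Dd Hd]].
  specialize (HI d Dd); specialize (Hn d); tauto.
Qed.
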